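(* Let $c\in(0,1]$ and let $n=n(p)$ be a function of $p$ with $n\ge p$ such that $p/n\to c$ as $p\to\infty$. Let $\mathbf{X}$ be either the $p\times n$ random Toeplitz matrix or the $p\times n$ random rectangular circulant matrix (both defined in the context), and let $\lambda_p$ be the smallest eigenvalue of $\mathbf{S}=\frac1n\mathbf{X}\mathbf{X}^\top$. Then, in both the Toeplitz and the circulant case, for every real $\kappa\ge1$, $$\mathbb{E}\left[(\lambda_p)^\kappa\right]\to0\quad\text{as }p\to\infty .$$
   Context: Let $x_i$, $i\in\mathbb{Z}$, be i.i.d. standard normal real random variables. For $n\ge p$, the random Toeplitz matrix is the $p\times n$ matrix $\mathbf{X}=(x_{j-i})_{1\le i\le p,\,1\le j\le n}$. The random rectangular circulant matrix is the $p\times n$ matrix $\mathbf{X}=(x_{(j-i)\bmod n})_{1\le i\le p,\,1\le j\le n}$, where $(j-i)\bmod n\in\{0,\dots,n-1\}$ (so its first row is $(x_0,x_1,\dots,x_{n-1})$ and each subsequent row is the cyclic right shift of the previous one). *)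

(* Defs.v *)
From HB Require Import structures.
From mathcomp Require Import all_boot all_order all_algebra.
From mathcomp Require Import all_classical all_reals all_analysis.

Set Implicit Arguments.
Unset Strict Implicit.
Unset Printing Implicit Defensive.

Import Order.TTheory GRing.Theory Num.Theory.
Import numFieldNormedType.Exports.

Local Open Scope classical_set_scope.
Local Open Scope ring_scope.

(* Mutual independence: the product rule over every finite set of indices,
   listed without repetition. *)
Definition mutually_independent d (T : measurableType d) (R : realType)
    (P : probability T R) (I : choiceType) (x : I -> {RV P >-> R}) : Prop :=
  forall (s : seq I) (B : I -> set R), uniq s ->
    (forall i, measurable (B i)) ->
    P (\bigcap_(i in [set` s]) (x i @^-1` B i)) =
    (\prod_(i <- s) P (x i @^-1` B i))%E.

(* The laws are compared on Borel sets only: measures are total functions whose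
   values on non-measurable sets are irrelevant. *)
Definition iid_std_normal d (T : measurableType d) (R : realType)
    (P : probability T R) (I : choiceType) (x : I -> {RV P >-> R}) : Prop :=
  mutually_independent x /\
  forall i (B : set R), measurable B ->
    distribution P (x i) B = normal_prob 0 1 B.

(* Rows and columns are indexed from 0, which leaves j - i unchanged. *)
Definition toeplitz_mx (R : Type) (p n : nat) (x : int -> R) : 'M[R]_(p, n) :=
  \matrix_(i < p, j < n) x (j%:Z - i%:Z).

Definition circulant_mx (R : Type) (p n : nat) (x : int -> R) : 'M[R]_(p, n) :=
  \matrix_(i < p, j < n) x ((j%:Z - i%:Z) %% n%:Z)%Z.

Definition sample_cov (R : realType) (p n : nat) (X : 'M[R]_(p, n)) : 'M[R]_p :=
  n%:R^-1 *: (X *m X^T).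

(* A matrix has finitely many eigenvalues, so this infimum is a minimum as soon
   as there is a real eigenvalue (e.g. for a symmetric matrix of positive size);
   otherwise it is the infimum of the empty set, namely 0. *)
Definition min_eigenvalue (R : realType) (p : nat) (A : 'M[R]_p) : R :=
  inf [set a | eigenvalue A a].

(* Main.v *)
Require Import Defs.
From HB Require Import structures.
From mathcomp Require Import all_boot all_order all_algebra.
From mathcomp Require Import all_classical all_reals all_analysis.
From mathcomp Require Import measurable_realfun.
From mathcomp Require Import ring lra zify.

Set Implicit Arguments.
Unset Strict Implicit.
Unset Printing Implicit Defensive.

Import Order.TTheory GRing.Theory Num.Theory.
Import numFieldNormedType.Exports.

Local Open Scope classical_set_scope.
Local Open Scope ring_scope.

(** The smallest eigenvalue is at most the Rayleigh quotient of any vector v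
    ([min_eigenvalue_le]), that is, up to normalisation, the squared norm of the
    convolution of v with the Gaussian sequence. The circulant matrix convolves on
    the cycle of length N = n; the rows of the Toeplitz matrix are pieces of rows of
    a circulant one with N = n + p - 1, which has a larger Rayleigh quotient. Both
    cases thus reduce to sums over a cycle with p <= N <= 2 n ([lam_power_bound]).

    Take for v the exponential of frequency 2 pi (j + 1) / b, where the block length
    b is a small fixed proportion of p. Cut the cycle into N / b blocks of length b.
    A window of length p is a union of full blocks, up to at most 4 b places, and on
    a full block a shifted exponential is a combination of one cosine and one sine.
    So, up to a proportion 4 b / p, the Rayleigh quotient of v is a quadratic
    function of the 2 (N / b) coordinates of the Gaussian sequence along these waves
    ([window_captured]). Waves of different blocks or frequencies are orthogonal
    ([block_wave_orthonormal]), hence their coordinates are independent standard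
    Gaussians. For one j all its coordinates are small with a positive probability
    that depends on N / b only, which stays bounded; as there are about b / 2
    frequencies, and b tends to infinity, some j has small coordinates with
    probability close to one.

    Instead of selecting j, the quotients are averaged with weights. Let q be a
    nonnegative polynomial of Gaussian mean one such that the law with density q
    with respect to the Gaussian has a second moment below eps
    ([concentrated_weight]), and let W_j be the product of the q's at the coordinates
    of frequency j. The eigenvalue is at most Num / Den, where Den is the average of
    the W_j and Num the average of W_j times the j-th quotient. The mean of Num is
    O(eps + b / p), since the weight damps the coordinates and is independent of the
    orthogonal rest ([Ex_weight_sqr]); Den has mean one and variance O(1 / b), by
    independence ([weight_average_var]). Finally [ratio_power_bound] combines both
    estimates with a bound on the moments of the quotient of the first basis vector.

    All these bounds are expectations of polynomials in the Gaussians. So the only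
    input from probability is the recursion [wick] for mixed moments, which follows
    from the product rule and integration by parts ([iid_wick]), and rotation
    invariance is a consequence of this recursion ([wick_lin]). *)

(** * Gaussian moments *)

Section weighted_pushforward.
Local Open Scope ereal_scope.
Context d d' (X : measurableType d) (Y : measurableType d') (R : realType).
Variables (mu : {measure set X -> \bar R}) (nu : {measure set Y -> \bar R}).
Variables (phi : X -> Y) (mphi : measurable_fun setT phi).
Variables (G : X -> R) (mG : measurable_fun setT G) (G0 : forall x, (0 <= G x)%R).
Variable c : R.
Hypothesis muG : forall B, measurable B ->
  \int[mu]_x (G x * \1_B (phi x))%:E = c%:E * nu B.

Import HBNNSimple.

(** Both sides are additive in f and commute with nondecreasing limits, so that it
    is enough to compare them on indicators. *)
Lemma ge0_integral_weighted (f : Y -> R) :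
  measurable_fun setT f -> (forall y, (0 <= f y)%R) ->
  \int[mu]_x (G x * f (phi x))%:E = c%:E * \int[nu]_y (f y)%:E.
Proof.
move=> mf f0.
have mEf : measurable_fun setT (fun y => (f y)%:E) by exact/measurable_EFinP.
pose h := nnsfun_approx measurableT mEf.
have cvh y : (EFin \o h n) y @[n --> \oo] --> (f y)%:E.
  by apply: cvg_nnsfun_approx => // z _; rewrite lee_fin.
have ndh y : {homo (fun n => h n y) : m n / (m <= n)%N >-> (m <= n)%R}.
  by move=> m n mn; exact/lefP/nd_nnsfun_approx.
have mhphi n : measurable_fun setT (fun x => h n (phi x)).
  exact: measurableT_comp.
have -> : \int[nu]_y (f y)%:E = limn (fun n => \int[nu]_y (h n y)%:E).
  rewrite -monotone_convergence//.
  - by apply: eq_integral => y _; apply/esym/cvg_lim => //; exact: cvh.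
  - by move=> n; exact/measurable_EFinP.
  - by move=> n y _; rewrite lee_fin.
  - by move=> y _ m n mn; rewrite lee_fin; exact: ndh.
have -> : \int[mu]_x (G x * f (phi x))%:E =
    limn (fun n => \int[mu]_x (G x * h n (phi x))%:E).
  rewrite -monotone_convergence//.
  - apply: eq_integral => x _; apply/esym/cvg_lim => //.
    rewrite EFinM.
    apply: (@cvg_trans _ ((fun n => (G x)%:E * (h n (phi x))%:E) @ \oo)).
      by apply: near_eq_cvg; apply: nearW => n; rewrite EFinM.
    by apply: cvgeZl => //; exact: cvh.
  - by move=> n; apply/measurable_EFinP; exact: measurable_funM.
  - by move=> n x _; rewrite lee_fin mulr_ge0.
  - by move=> x _ m n mn; rewrite lee_fin ler_wpM2l//; exact: ndh.
rewrite -limeMl//; last first.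
  apply: ereal_nondecreasing_is_cvgn => m n mn; apply: ge0_le_integral => //.
  - by move=> y _; rewrite lee_fin.
  - exact/measurable_EFinP.
  - exact/measurable_EFinP.
  - by move=> y _; rewrite lee_fin; exact: ndh.
congr (limn _); apply/funext => n.
have mind r : measurable_fun setT (fun x => r * \1_(h n @^-1` [set r]) (phi x))%R.
  apply: measurable_funM => //.
  by apply: (measurableT_comp _ mphi); exact: measurable_indic.
have ind0 r x : (0 <= r * \1_(h n @^-1` [set r]) x)%R.
  by have := nnfun_muleindic_ge0 (h n) r x; rewrite lee_fin.
transitivity (\int[mu]_x (\sum_(y \in range (h n))
    (G x * (y * \1_(h n @^-1` [set y]) (phi x)))%:E)).
  apply: eq_integral => x _; rewrite fimfunE EFinM -fsumEFin//.
  rewrite ge0_mule_fsumr//; last by move=> y; exact: nnfun_muleindic_ge0.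
rewrite ge0_integral_fsum//; last 2 first.
- by move=> r; apply/measurable_EFinP; exact: measurable_funM.
- by move=> r x _; rewrite lee_fin mulr_ge0.
transitivity (c%:E * \int[nu]_x (\sum_(y \in range (h n))
    (y * \1_(h n @^-1` [set y]) x)%:E)); last first.
  by congr (_ * _); apply: eq_integral => x _; rewrite fimfunE -fsumEFin.
rewrite ge0_integral_fsum//; last 2 first.
- by move=> r; apply/measurable_EFinP; exact: measurable_funM.
- by move=> r x _; exact: nnfun_muleindic_ge0.
rewrite ge0_mule_fsumr//; last first.
  by move=> r; apply: integral_ge0 => y _; exact: nnfun_muleindic_ge0.
apply: eq_fsbigr => r rh.
rewrite integralZl_indic_nnsfun// integral_indic// setIT.
transitivity (r%:E * \int[mu]_x (G x * \1_(h n @^-1` [set r]) (phi x))%:E).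
  rewrite -ge0_integralZl//.
  - by apply: eq_integral => x _; rewrite -EFinM mulrCA.
  - apply/measurable_EFinP; apply: measurable_funM => //.
    by apply: (measurableT_comp _ mphi); exact: measurable_indic.
  - by move=> x _; rewrite lee_fin mulr_ge0.
  - move: rh; rewrite inE => -[y _ <-]; by rewrite lee_fin.
by rewrite muG// muleCA.
Qed.
End weighted_pushforward.

Section improper_primitive.
Context (R : realType).
Local Notation mu := (@lebesgue_measure R).

(** The integral over [-n, n] is F(n) - F(-n), and dominated convergence applies. *)
Lemma integral_derive_eq0 (f F : R -> R) :
  continuous f -> mu.-integrable setT (EFin \o f) ->
  (forall x, is_derive x (1 : R) F (f x)) ->
  (fun n : nat => F n.+1%:R) @ \oo --> (0 : R) ->
  (fun n : nat => F (- n.+1%:R)) @ \oo --> (0 : R) ->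
  (\int[mu]_x (f x)%:E = 0)%E.
Proof.
move=> cf intf dF Fy FNy.
pose I n : set R := `[- (n.+1%:R : R), n.+1%:R]%classic.
pose f_ n : R -> \bar R := (EFin \o f) \_ (I n).
have mI n : measurable (I n) by exact: measurable_itv.
have mf : measurable_fun setT (EFin \o f) by exact: measurable_int intf.
have intI n : (\int[mu]_x f_ n x)%E = (F n.+1%:R - F (- n.+1%:R))%:E.
  rewrite -integral_mkcond (continuous_FTC2 (F := F)) ?EFinB//.
  - by apply: (@lt_trans _ _ 0); rewrite ?oppr_lt0 ltr0n.
  - exact: continuous_subspaceT.
  - have cF : continuous F.
      move=> x; apply/differentiable_continuous/derivable1_diffP.
      by have [] := dF x.
    split; first by move=> x _; have [] := dF x.
    + by apply: cvg_at_right_filter; exact: cF.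
    + by apply: cvg_at_left_filter; exact: cF.
  - by move=> x _; rewrite derive1E; apply/derive_val.
have [| | | | |_ _ cv] := @dominated_convergence _ _ R mu setT measurableT f_
    (EFin \o f) (abse \o (EFin \o f)).
- by move=> n; apply/(measurable_restrictT _ (mI n)); apply: measurable_funTS.
- by [].
- apply: aeW => x _; apply: cvg_near_cst; near=> n.
  suff xn : `|x| <= n.+1%:R.
    by rewrite /f_ patchE mem_set// /I/= in_itv/= -ler_norml.
  near: n; exists (Num.truncn `|x|) => // n /= ln.
  by apply/ltW/(lt_le_trans (truncnS_gt _)); rewrite ler_nat.
- exact: integrable_abse.
- apply: aeW => x n _; rewrite /f_ patchE; case: ifP => //= _.
  by rewrite normr0 lee_fin.
apply: cvg_unique cv _ => //.
rewrite (_ : [sequence _]_n = fun n => (F n.+1%:R - F (- n.+1%:R))%:E); last first.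
  by apply/funext => n; exact: intI.
apply: cvg_EFin; first exact: nearW.
by rewrite -[X in _ --> X](subr0 (0:R)); exact: cvgB.
Unshelve. all: by end_near. Qed.

End improper_primitive.

Section gaussian_moments.
Context (R : realType).
Local Notation mu := (@lebesgue_measure R).
Local Notation phi := (@normal_pdf R 0 1).

Lemma normal_pdf01E x : phi x = normal_peak 1 * expR (- (x ^+ 2 / 2)).
Proof.
rewrite normal_pdfE ?oner_neq0//; congr (_ * expR _).
by rewrite subr0 expr1n mulNr.
Qed.

(** A polynomial is absorbed by half of the Gaussian exponent. *)
Lemma exprn_normal_pdf_le k : {C : R | 0 <= C &
  forall x, `|x| ^+ k * phi x <= C * normal_pdf 0 (Num.sqrt 2) x}.
Proof.
pose c := normal_peak 1 / normal_peak (Num.sqrt 2) : R.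
have s0 : Num.sqrt 2 != 0 :> R by rewrite sqrtr_eq0 -ltNge.
have pk0 : 0 < normal_peak (Num.sqrt 2) :> R by exact: normal_peak_gt0.
exists ((1 + 4 ^+ k.+1 * (k.+1)`!%:R) * c).
  by rewrite mulr_ge0 ?divr_ge0 ?normal_peak_ge0// addr_ge0// mulr_ge0.
move=> x; rewrite normal_pdf01E normal_pdfE// /normal_fun subr0 sqr_sqrtr//.
rewrite -[leRHS]mulrA [c * _]mulrA divfK ?gt_eqF// mulrCA [leRHS]mulrCA.
rewrite ler_wpM2l ?normal_peak_ge0//.
have -> : expR (- (x ^+ 2 / 2)) = expR (- (x ^+ 2 / 4)) * expR (- (x ^+ 2 / 4)).
  by rewrite -expRD; congr expR; field.
have -> : - x ^+ 2 / (2 *+ 2) = - (x ^+ 2 / 4) :> R by rewrite -mulr_natr mulNr -natrM.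
rewrite mulrA ler_wpM2r ?expR_ge0// expRN ler_pdivrMr ?expR_gt0//.
have y0 : 0 <= x ^+ 2 / 4 by rewrite divr_ge0// sqr_ge0.
have := expR_ge1Dxn k y0; set e := expR _ => le_e.
have e1 : 1 <= e by apply: le_trans le_e; rewrite lerDl divr_ge0// exprn_ge0.
have e0 : 0 <= e by exact: le_trans e1.
apply: (@le_trans _ _ (1 + `|x| ^+ (2 * k.+1))).
  have [x1|/ltW x1] := leP `|x| 1.
    by apply: (@le_trans _ _ 1); [exact: exprn_ile1|rewrite lerDl exprn_ge0].
  by rewrite (@le_trans _ _ (`|x| ^+ (2 * k.+1)))// ?lerDr// ler_weXn2l//; lia.
rewrite mulrDl mul1r lerD// -mulrA exprM -normrX ger0_norm ?sqr_ge0//.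
rewrite (_ : x ^+ 2 ^+ k.+1 = 4 ^+ k.+1 * (x ^+ 2 / 4) ^+ k.+1); last first.
  by rewrite -exprMn; congr (_ ^+ _); field.
rewrite ler_wpM2l// -ler_pdivrMl ?ltr0n ?fact_gt0// mulrC.
by apply: le_trans le_e; rewrite lerDr.
Qed.

Lemma integrable_exprn_normal_pdf k :
  mu.-integrable setT (EFin \o (fun x => x ^+ k * phi x)).
Proof.
have [C C0 le_C] := exprn_normal_pdf_le k.
apply: (le_integrable measurableT _ _ (integrableZl measurableT C
   (integrable_normal_pdf 0 (Num.sqrt 2)))).
  apply/measurable_EFinP; apply: measurable_funM; last exact: measurable_normal_pdf.
  exact: measurable_funX.
move=> x _; rewrite -EFinM !abse_EFin lee_fin [leLHS]normrM normrX.
by rewrite (ger0_norm (normal_pdf_ge0 _ _ _)) (le_trans (le_C x))// ler_norm.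
Qed.

Definition gauss_mom k : R := \int[mu]_x (x ^+ k * phi x).

Lemma is_derive_exprn_normal_pdf k (x : R) :
  is_derive x (1 : R) (fun x => x ^+ k * phi x)
    (k%:R * x ^+ k.-1 * phi x - x ^+ k.+1 * phi x).
Proof.
have -> : (fun x : R => x ^+ k * phi x) =
   (fun x => x ^+ k * (normal_peak 1 * expR (- (x ^+ 2 / 2)))).
  by apply/funext => y; rewrite normal_pdf01E.
rewrite normal_pdf01E.
have d0 : is_derive x (1:R) (fun x : R => - (x ^+ 2 / 2)) (- x).
  have -> : (fun x : R => - (x ^+ 2 / 2)) = - (2^-1 *: (id ^+ 2 : R -> R)).
    by apply/funext => y /=; rewrite !fctE /GRing.scale/= mulrC.
  by apply: is_derive_eq; rewrite /GRing.scale/=; field.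
have d1 : is_derive x (1:R) (fun x : R => expR (- (x ^+ 2 / 2)))
    (expR (- (x ^+ 2 / 2)) * - x).
  exact: (@is_derive1_comp _ expR (fun x : R => - (x ^+ 2 / 2))).
have dk : is_derive x (1:R) (fun x : R => x ^+ k) (k%:R * x ^+ k.-1).
  have -> : (fun x : R => x ^+ k) = (id ^+ k : R -> R).
    by apply/funext => y /=; rewrite !fctE.
  by apply: is_derive_eq; rewrite /GRing.scale/= mulr1.
have -> : (fun x : R => x ^+ k * (normal_peak 1 * expR (- (x ^+ 2 / 2)))) =
   (normal_peak 1 : R) *: ((fun x : R => x ^+ k) * (fun x => expR (- (x ^+ 2 / 2)))).
  by apply/funext => y /=; rewrite !fctE /GRing.scale/= mulrCA.
apply: is_derive_eq; rewrite /GRing.scale/= [x ^+ k.+1]exprS; ring.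
Qed.

Lemma exprn_normal_pdf_cvg0 k (u : nat -> R) :
  (forall n, `|u n| = n.+1%:R) ->
  (fun n => u n ^+ k * phi (u n)) @ \oo --> (0 : R).
Proof.
move=> un; have [C C0 le_C] := exprn_normal_pdf_le k.+1.
apply: norm_cvg0; pose D := C * normal_peak (Num.sqrt 2) : R.
apply: (@squeeze_cvgr _ _ _ _ (cst 0) (fun n => D * harmonic n)).
- apply: nearW => n; rewrite normr_ge0 /= normrM normrX un.
  rewrite (ger0_norm (normal_pdf_ge0 _ _ _)) /harmonic ler_pdivlMr// mulrAC -exprSr.
  rewrite -un (le_trans (le_C _))// ler_wpM2l// normal_pdf_ub// sqrtr_eq0 -ltNge//.
- exact: cvg_cst.
- by rewrite -[X in _ --> X](mulr0 D); apply: cvgM; [exact: cvg_cst|exact: cvg_harmonic].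
Qed.

(** Stein's identity for monomials: x^k times the density vanishes at infinity. *)
Lemma gauss_mom_rec k : gauss_mom k.+1 = k%:R * gauss_mom k.-1.
Proof.
pose f x : R := k%:R * x ^+ k.-1 * phi x - x ^+ k.+1 * phi x.
have ik j := integrable_exprn_normal_pdf j.
have fE : f = fun x => k%:R * (x ^+ k.-1 * phi x) - x ^+ k.+1 * phi x.
  by apply/funext => x; rewrite /f mulrA.
have ikk : mu.-integrable setT (EFin \o (fun x => k%:R * (x ^+ k.-1 * phi x))).
  exact: (integrableZl measurableT k%:R (ik k.-1)).
have if_ : mu.-integrable setT (EFin \o f).
  by rewrite fE; exact: (integrableB measurableT ikk (ik k.+1)).
have := @integral_derive_eq0 R f (fun x => x ^+ k * phi x) _ if_
   (is_derive_exprn_normal_pdf k) _ _.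
rewrite -/(Rintegral _ _ _) => int0.
have : \int[mu]_x f x = 0.
  rewrite /Rintegral int0//.
  - have cphi : continuous phi by apply: continuous_normal_pdf; exact: oner_neq0.
    move=> x; apply: cvgB; apply: cvgM; last exact: cphi.
    + by apply: cvgM; [exact: cvg_cst|exact: exprn_continuous].
    + exact: cphi.
    + exact: exprn_continuous.
  - by apply: exprn_normal_pdf_cvg0 => n; rewrite ger0_norm.
  - by apply: exprn_normal_pdf_cvg0 => n; rewrite normrN ger0_norm.
rewrite fE RintegralB// RintegralZl//.
by move/eqP; rewrite subr_eq0 => /eqP ->.
Qed.

Lemma gauss_mom0 : gauss_mom 0 = 1.
Proof.
rewrite /gauss_mom /Rintegral; under eq_integral do rewrite expr0 mul1r.
by rewrite integral_normal_pdf.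
Qed.

Lemma gauss_mom1 : gauss_mom 1 = 0.
Proof. by rewrite gauss_mom_rec mul0r. Qed.

End gaussian_moments.

(** * Random variables with moments of all orders *)

Section moments.
Context d (T : measurableType d) (R : realType) (P : probability T R).
Implicit Types f g : T -> R.

(** Moments of all orders are required because, unlike integrability, their finiteness
    is stable under products, hence under polynomial operations. *)
Definition has_moments f := measurable_fun setT f /\
  forall k, P.-integrable setT (EFin \o (fun w => `|f w| ^+ k)).

Definition Ex f : R := \int[P]_w f w.

Lemma le_has_moments f g : measurable_fun setT f ->
  (forall w, `|f w| <= `|g w|) -> has_moments g -> has_moments f.
Proof.
move=> mf fg [mg ig]; split => // k.
apply: (le_integrable measurableT _ _ (ig k)).
  by apply/measurable_EFinP; apply: measurable_funX; exact: measurableT_comp.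
by move=> w _; rewrite !abse_EFin lee_fin !normrX !normr_id lerXn2r ?nnegrE.
Qed.

Lemma has_moments_integrable f : has_moments f -> P.-integrable setT (EFin \o f).
Proof.
move=> [mf /(_ 1)]; apply: le_integrable => //; first exact/measurable_EFinP.
by move=> w _; rewrite !abse_EFin lee_fin expr1 normr_id.
Qed.

Lemma has_moments_cst (a : R) : has_moments (fun=> a).
Proof.
split; first exact: measurable_cst.
by move=> k; exact: (finite_measure_integrable_cst P (`|a| ^+ k) measurableT).
Qed.

Lemma has_momentsD f g : has_moments f -> has_moments g ->
  has_moments (fun w => f w + g w).
Proof.
move=> [mf fi] [mg gi]; split; first exact: measurable_funD.
move=> k.
have : P.-integrable setT (EFin \o (fun w => 2 ^+ k * (`|f w| ^+ k + `|g w| ^+ k))).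
  exact: (integrableZl measurableT (2 ^+ k) (integrableD measurableT (fi k) (gi k))).
apply: le_integrable => //.
  by apply/measurable_EFinP; apply: measurable_funX; apply: measurableT_comp => //;
    exact: measurable_funD.
move=> w _; rewrite /= lee_fin normrX normr_id [leRHS]ger0_norm; last first.
  by rewrite mulr_ge0 ?exprn_ge0// addr_ge0 ?exprn_ge0.
rewrite (@le_trans _ _ ((2 * Num.max `|f w| `|g w|) ^+ k))//.
  rewrite lerXn2r ?nnegrE// ?mulr_ge0 ?le_max ?normr_ge0//.
  by rewrite (le_trans (ler_normD _ _))// mulr_natl mulr2n lerD// le_max lexx ?orbT.
rewrite exprMn ler_wpM2l ?exprn_ge0//.
by case: (leP `|f w| `|g w|) => _; rewrite ?lerDl ?lerDr exprn_ge0.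
Qed.

Lemma has_momentsM f g : has_moments f -> has_moments g ->
  has_moments (fun w => f w * g w).
Proof.
move=> [mf fi] [mg gi]; split; first exact: measurable_funM.
move=> k.
have : P.-integrable setT (EFin \o (fun w => `|f w| ^+ (k * 2) + `|g w| ^+ (k * 2))).
  exact: (integrableD measurableT (fi (k * 2)%N) (gi (k * 2)%N)).
apply: le_integrable => //.
  by apply/measurable_EFinP; apply: measurable_funX; apply: measurableT_comp => //;
    exact: measurable_funM.
move=> w _; rewrite /= lee_fin normrX normr_id [leRHS]ger0_norm; last first.
  by rewrite addr_ge0 ?exprn_ge0.
rewrite normrM exprMn !exprM.
set a := _ ^+ k; set b := _ ^+ k.
have a0 : 0 <= a by rewrite exprn_ge0.
have b0 : 0 <= b by rewrite exprn_ge0.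
by nra.
Qed.

Lemma has_momentsZ (a : R) f : has_moments f -> has_moments (fun w => a * f w).
Proof. by move=> fi; apply: has_momentsM => //; exact: has_moments_cst. Qed.

Lemma has_momentsB f g : has_moments f -> has_moments g ->
  has_moments (fun w => f w - g w).
Proof.
move=> fi gi; rewrite (_ : (fun w => _) = (fun w => f w + (-1) * g w)).
  by apply: has_momentsD => //; exact: has_momentsZ.
by apply/funext => w; rewrite mulN1r.
Qed.

Lemma has_moments_sum (I : Type) (s : seq I) (Q : pred I) (F : I -> T -> R) :
  (forall i, Q i -> has_moments (F i)) ->
  has_moments (fun w => \sum_(i <- s | Q i) F i w).
Proof.
move=> Fi; elim: s => [|i s IH].
  by under eq_fun do rewrite big_nil; exact: has_moments_cst.
under eq_fun do rewrite big_cons; case Qi: (Q i) => //.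
by apply: has_momentsD => //; exact: Fi.
Qed.

Lemma has_moments_prod (I : Type) (s : seq I) (Q : pred I) (F : I -> T -> R) :
  (forall i, Q i -> has_moments (F i)) ->
  has_moments (fun w => \prod_(i <- s | Q i) F i w).
Proof.
move=> Fi; elim: s => [|i s IH].
  by under eq_fun do rewrite big_nil; exact: has_moments_cst.
under eq_fun do rewrite big_cons; case Qi: (Q i) => //.
by apply: has_momentsM => //; exact: Fi.
Qed.

Lemma has_momentsX f k : has_moments f -> has_moments (fun w => f w ^+ k).
Proof.
move=> fi; elim: k => [|k IH]; first exact: has_moments_cst.
by under eq_fun do rewrite exprS; exact: has_momentsM.
Qed.

Lemma has_moments_horner f (p : {poly R}) : has_moments f ->
  has_moments (fun w => p.[f w]).
Proof.
move=> fi; under eq_fun do rewrite horner_coef.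
by apply: has_moments_sum => i _; apply/has_momentsZ/has_momentsX.
Qed.

Lemma eq_Ex f g : f =1 g -> Ex f = Ex g.
Proof. by move=> /funext ->. Qed.

Lemma Ex_cst (a : R) : Ex (fun=> a) = a.
Proof.
rewrite /Ex Rintegral_cst// (_ : fine _ = 1) ?mulr1//.
by rewrite -[RHS]/(fine 1%E); congr fine; exact: probability_setT.
Qed.

Lemma ExD f g : has_moments f -> has_moments g ->
  Ex (fun w => f w + g w) = Ex f + Ex g.
Proof. by move=> ? ?; apply: RintegralD => //; exact: has_moments_integrable. Qed.

Lemma ExB f g : has_moments f -> has_moments g ->
  Ex (fun w => f w - g w) = Ex f - Ex g.
Proof. by move=> ? ?; apply: RintegralB => //; exact: has_moments_integrable. Qed.

Lemma ExZ (a : R) f : has_moments f -> Ex (fun w => a * f w) = a * Ex f.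
Proof. by move=> ?; apply: RintegralZl => //; exact: has_moments_integrable. Qed.

Lemma Ex_sum (I : Type) (s : seq I) (Q : pred I) (F : I -> T -> R) :
  (forall i, Q i -> has_moments (F i)) ->
  Ex (fun w => \sum_(i <- s | Q i) F i w) = \sum_(i <- s | Q i) Ex (F i).
Proof.
move=> Fi; elim: s => [|i s IH].
  by rewrite big_nil; under [X in Ex X]eq_fun do rewrite big_nil; exact: Ex_cst.
rewrite big_cons; under [X in Ex X]eq_fun do rewrite big_cons.
case Qi: (Q i) => //; rewrite ExD ?IH//; first exact: Fi.
exact: has_moments_sum.
Qed.

Lemma Ex_le f g : has_moments f -> has_moments g ->
  (forall w, f w <= g w) -> Ex f <= Ex g.
Proof.
by move=> fi gi fg; apply: le_Rintegral => //; exact: has_moments_integrable.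
Qed.

Lemma EFin_Ex f : has_moments f -> ((Ex f)%:E = \int[P]_w (f w)%:E)%E.
Proof.
move=> fi; rewrite fineK//; apply: integrable_fin_num => //.
exact: has_moments_integrable.
Qed.

End moments.

Section signed_powers.
Context (R : realType) (k : nat).
Definition expr_pos (y : R) := Num.max (y ^+ k) 0.
Definition expr_neg (y : R) := Num.max (- y ^+ k) 0.

Lemma expr_posneg y : y ^+ k = expr_pos y - expr_neg y.
Proof.
rewrite /expr_pos /expr_neg; case: (leP (y ^+ k) 0) => [y0|/ltW y0].
  rewrite (_ : Num.max (- y ^+ k) 0 = - y ^+ k) ?sub0r ?opprK//.
  by apply/max_idPl; rewrite oppr_ge0.
rewrite (_ : Num.max (- y ^+ k) 0 = 0) ?subr0//.
by apply/max_idPr; rewrite oppr_le0.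
Qed.

Lemma expr_pos_ge0 y : 0 <= expr_pos y.
Proof. by rewrite le_max lexx orbT. Qed.

Lemma expr_neg_ge0 y : 0 <= expr_neg y.
Proof. by rewrite le_max lexx orbT. Qed.

Lemma expr_pos_le y : `|expr_pos y| <= `|y ^+ k|.
Proof. by rewrite ger0_norm ?expr_pos_ge0// ge_max ler_norm normr_ge0. Qed.

Lemma expr_neg_le y : `|expr_neg y| <= `|y ^+ k|.
Proof. by rewrite ger0_norm ?expr_neg_ge0// ge_max -normrN ler_norm normr_ge0. Qed.

Lemma measurable_expr_pos : measurable_fun setT expr_pos.
Proof. by apply: measurable_maxr => //; exact: measurable_funX. Qed.

Lemma measurable_expr_neg : measurable_fun setT expr_neg.
Proof.
by apply: measurable_maxr => //; apply: measurableT_comp => //; exact: measurable_funX.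
Qed.
End signed_powers.

Section std_normal.
Context d (T : measurableType d) (R : realType) (P : probability T R).
Variable X : {RV P >-> R}.
Hypothesis lawX : forall B : set R, measurable B ->
  distribution P X B = normal_prob 0 1 B.
Local Notation mu := (@lebesgue_measure R).
Local Notation phi := (@normal_pdf R 0 1).

Lemma ge0_integral_std_normal (h : R -> R) :
  measurable_fun setT h -> (forall y, 0 <= h y) ->
  (\int[P]_w (h (X w))%:E = \int[mu]_y (phi y * h y)%:E)%E.
Proof.
move=> mh h0.
transitivity (\int[distribution P X]_y (h y)%:E)%E.
  by rewrite ge0_integral_distribution//; exact/measurable_EFinP.
rewrite (@ge0_integral_weighted _ _ _ _ R mu (distribution P X) id _ phi _ _ 1)//.
- by rewrite mul1e.
- exact: measurable_normal_pdf.
- by move=> x; exact: normal_pdf_ge0.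
- move=> B mB; rewrite mul1e; apply: (@etrans _ _ (normal_prob 0 1 B)); last exact/esym/lawX.
  rewrite /normal_prob [RHS]integral_mkcond.
  apply: eq_integral => x _; rewrite patchE indicE.
  by case: ifP => xB; rewrite /= ?mulr1 ?mulr0.
Qed.

Lemma has_moments_std_normal : has_moments P X.
Proof.
split => // k; apply/integrableP; split.
  by apply/measurable_EFinP; apply: measurable_funX; exact: measurableT_comp.
rewrite [ltLHS](_ : _ = \int[P]_w (`|X w| ^+ k)%:E)%E; last first.
  by apply: eq_integral => w _; rewrite /= ger0_norm// exprn_ge0.
rewrite (ge0_integral_std_normal (h := fun y => `|y| ^+ k)); last 2 first.
- by apply: measurable_funX; exact: normr_measurable.
- by move=> y; rewrite exprn_ge0.
have /integrableP[_] := integrable_exprn_normal_pdf R k.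
rewrite [ltLHS](_ : _ = \int[mu]_y (phi y * `|y| ^+ k)%:E)%E//.
apply: eq_integral => y _; rewrite /= normrM normrX mulrC ger0_norm//.
exact: normal_pdf_ge0.
Qed.

Lemma Ex_std_normalX k : Ex P (fun w => X w ^+ k) = gauss_mom R k.
Proof.
pose a : R -> R := expr_pos k; pose b : R -> R := expr_neg k.
have [[ma a0] lea] := (@measurable_expr_pos R k, @expr_pos_ge0 R k, @expr_pos_le R k).
have [[mb b0] leb] := (@measurable_expr_neg R k, @expr_neg_ge0 R k, @expr_neg_le R k).
have ab := @expr_posneg R k.
have hk := has_momentsX k has_moments_std_normal.
have ha : has_moments P (fun w => a (X w)).
  apply: le_has_moments hk => //; exact: measurableT_comp.
have hb : has_moments P (fun w => b (X w)).
  apply: le_has_moments hk => //; exact: measurableT_comp.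
have il (c : R -> R) : measurable_fun setT c -> (forall y, `|c y| <= `|y ^+ k|) ->
    mu.-integrable setT (EFin \o (fun y => phi y * c y)).
  move=> mc lec; apply: (le_integrable measurableT _ _ (integrable_exprn_normal_pdf R k)).
    by apply/measurable_EFinP; apply: measurable_funM => //; exact: measurable_normal_pdf.
  by move=> y _; rewrite /= lee_fin !normrM mulrC ler_wpM2r.
have -> : Ex P (fun w => X w ^+ k) = Ex P (fun w => a (X w)) - Ex P (fun w => b (X w)).
  by rewrite -ExB//; congr Ex; apply/funext => w.
have -> : gauss_mom R k = \int[mu]_y (phi y * a y) - \int[mu]_y (phi y * b y).
  rewrite -RintegralB//; [|exact: il|exact: il].
  by apply: eq_Rintegral => y _; rewrite ab mulrC mulrBr.
by congr (_ - _); rewrite /Ex /Rintegral ge0_integral_std_normal.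
Qed.
End std_normal.

(** * Independence and Wick's rule *)

Section independence.
Context d (T : measurableType d) (R : realType) (P : probability T R).
Variables (I : choiceType) (x : I -> {RV P >-> R}).
Hypothesis ind : mutually_independent x.

(** The product rule passes from indicators to nonnegative functions one
    coordinate at a time: the other factors form a density. *)
Lemma Ex_prod_indep_nneg (s1 s2 : seq I) (f : I -> R -> R) (B : I -> set R) :
  uniq (s1 ++ s2) ->
  (forall i, measurable_fun setT (f i)) -> (forall i y, 0 <= f i y) ->
  (forall i, has_moments P (fun w => f i (x i w))) ->
  (forall i, measurable (B i)) ->
  (\int[P]_w ((\prod_(i <- s1) f i (x i w)) * \prod_(i <- s2) \1_(B i) (x i w))%:E =
   ((\prod_(i <- s1) Ex P (fun w => f i (x i w))) *
     \prod_(i <- s2) Ex P (fun w => \1_(B i) (x i w)))%:E)%E.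
Proof.
have mpre i (A : set R) : measurable A -> measurable (x i @^-1` A).
  by move=> mA; rewrite -[X in measurable X]setTI; exact: measurable_funP.
have ExI i (A : set R) : measurable A ->
    Ex P (fun w => \1_A (x i w)) = fine (P (x i @^-1` A)).
  move=> mA; rewrite /Ex /Rintegral; congr fine.
  by rewrite -[in RHS](setIT (x i @^-1` A)) -integral_indic//; exact: mpre.
move=> + mf f0 hf; elim: s1 s2 B => [|i s1 IH] s2 B.
  move=> us2 mB; rewrite big_nil mul1r.
  transitivity (P (\bigcap_(i in [set` s2]) (x i @^-1` B i))).
    rewrite -[in RHS](setIT (\bigcap_(i in _) _)) -integral_indic//; last first.
      by apply: fin_bigcap_measurable => // i _; exact: mpre.
    apply: eq_integral => w _; congr EFin; rewrite big_nil mul1r.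
    rewrite bigcap_seq; elim: s2 {us2} => [|i s2 IH]; first by rewrite !big_nil indicT.
    by rewrite !big_cons IH indicI.
  rewrite ind// (big_morph EFin (@EFinM R) erefl); apply: eq_bigr => i _.
  by rewrite ExI// fineK// fin_num_measure//; exact: mpre.
rewrite cat_cons cons_uniq => /andP[iN us12] mB.
have i2 : i \notin s2 by apply: contra iN; rewrite mem_cat => ->; rewrite orbT.
pose G w := (\prod_(i <- s1) f i (x i w)) * \prod_(i <- s2) \1_(B i) (x i w).
have mG : measurable_fun setT G.
  apply: measurable_funM; apply: measurable_prod => j _.
    exact: (measurableT_comp (mf j)).
  by apply: measurableT_comp => //; exact: measurable_indic.
have G0 w : 0 <= G w.
  by apply: mulr_ge0; apply: prodr_ge0 => j _; [exact: f0|rewrite indicE].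
pose c := (\prod_(i <- s1) Ex P (fun w => f i (x i w))) *
  \prod_(i <- s2) Ex P (fun w => \1_(B i) (x i w)).
have PG A : measurable A ->
    (\int[P]_w (G w * \1_A (x i w))%:E = c%:E * distribution P (x i) A)%E.
  move=> mA; pose B' j := if j == i then A else B j.
  have B's2 j : j \in s2 -> B' j = B j.
    by move=> js2; rewrite /B'; case: eqP => // ji; rewrite -ji js2 in i2.
  have us : uniq (s1 ++ i :: s2) by rewrite -cat1s uniq_catCA /= iN.
  have mB' j : measurable (B' j) by rewrite /B'; case: ifP.
  have s2E w : \prod_(j <- i :: s2) \1_(B' j) (x j w) =
      \1_A (x i w) * \prod_(j <- s2) \1_(B j) (x j w) :> R.
    rewrite big_cons {1}/B' eqxx; congr (_ * _).
    by apply: eq_big_seq => j js2; rewrite B's2.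
  rewrite [LHS](_ : _ = \int[P]_w ((\prod_(i <- s1) f i (x i w)) *
     \prod_(i <- i :: s2) \1_(B' i) (x i w))%:E)%E; last first.
    by apply: eq_integral => w _; rewrite s2E mulrCA mulrC.
  rewrite IH// big_cons {1}/B' eqxx ExI// /c.
  rewrite (_ : \prod_(j <- s2) Ex P (fun w => \1_(B' j) (x j w)) =
     \prod_(j <- s2) Ex P (fun w => \1_(B j) (x j w))); last first.
    by apply: eq_big_seq => j js2; rewrite B's2.
  rewrite mulrCA mulrC EFinM; congr (_ * _)%E.
  by rewrite fineK// fin_num_measure//; exact: mpre.
rewrite [LHS](_ : _ = \int[P]_w (G w * f i (x i w))%:E)%E; last first.
  by apply: eq_integral => w _; congr EFin; rewrite big_cons /G; ring.
rewrite (ge0_integral_weighted (measurable_funPT (x i)) mG G0 PG (mf i) (f0 i)).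
have mEf : measurable_fun setT (EFin \o f i) by apply/measurable_EFinP; exact: mf.
have Ef0 y : (0 <= (EFin \o f i) y)%E by rewrite lee_fin; exact: f0.
have := ge0_integral_distribution (x i) mEf Ef0 => ->.
by rewrite -(EFin_Ex (hf i)) -EFinM big_cons /c; congr EFin; ring.
Qed.

(** Signed factors are differences of nonnegative ones. *)
Lemma Ex_prod_indep (s1 s2 : seq I) (f a b g : I -> R -> R) :
  uniq (s1 ++ s2) ->
  (forall i y, f i y = a i y - b i y) ->
  (forall i, measurable_fun setT (a i)) -> (forall i y, 0 <= a i y) ->
  (forall i, has_moments P (fun w => a i (x i w))) ->
  (forall i, measurable_fun setT (b i)) -> (forall i y, 0 <= b i y) ->
  (forall i, has_moments P (fun w => b i (x i w))) ->
  (forall i, measurable_fun setT (g i)) -> (forall i y, 0 <= g i y) ->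
  (forall i, has_moments P (fun w => g i (x i w))) ->
  Ex P (fun w => (\prod_(i <- s1) f i (x i w)) * \prod_(i <- s2) g i (x i w)) =
  (\prod_(i <- s1) Ex P (fun w => f i (x i w))) *
    \prod_(i <- s2) Ex P (fun w => g i (x i w)).
Proof.
move=> + fab ma a0 ha mb b0 hb.
have hf i : has_moments P (fun w => f i (x i w)).
  by under eq_fun do rewrite fab; exact: has_momentsB.
elim: s1 s2 g => [|i s1 IH] s2 g us12 mg g0 hg.
  rewrite big_nil mul1r; apply: EFin_inj; rewrite EFin_Ex; last first.
    apply: has_momentsM; first by under eq_fun do rewrite big_nil; exact: has_moments_cst.
    exact: has_moments_prod.
  have := @Ex_prod_indep_nneg s2 [::] g (fun=> setT).
  rewrite cats0 => /(_ us12 mg g0 hg (fun=> measurableT)).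
  rewrite big_nil mulr1 => <-; apply: eq_integral => w _.
  by rewrite !big_nil mul1r mulr1.
move: us12; rewrite cat_cons cons_uniq => /andP[iN us12].
have i2 : i \notin s2 by apply: contra iN; rewrite mem_cat => ->; rewrite orbT.
have us : uniq (s1 ++ i :: s2) by rewrite -cat1s uniq_catCA /= iN.
(* h takes the place of f at index i, which moves from s1 to s2 *)
pose upd (h : I -> R -> R) j := if j == i then h i else g j.
have hs (h : I -> R -> R) : (forall i, has_moments P (fun w => h i (x i w))) ->
    has_moments P (fun w => (\prod_(j <- s1) f j (x j w)) *
      \prod_(j <- i :: s2) upd h j (x j w)).
  move=> hh; apply: has_momentsM; apply: has_moments_prod => // j _.
  by rewrite /upd; case: ifP => // /eqP ->.
have updE (h : I -> R -> R) (Z : (R -> R) -> I -> R) :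
    \prod_(j <- i :: s2) Z (upd h j) j = Z (h i) i * \prod_(j <- s2) Z (g j) j.
  rewrite big_cons {1}/upd eqxx; congr (_ * _); apply: eq_big_seq => j js2.
  by rewrite /upd; case: eqP => // ji; rewrite -ji js2 in i2.
transitivity (Ex P (fun w => (\prod_(j <- s1) f j (x j w)) *
      \prod_(j <- i :: s2) upd a j (x j w)) - Ex P (fun w => (\prod_(j <- s1) f j (x j w)) *
      \prod_(j <- i :: s2) upd b j (x j w))).
  rewrite -ExB; [|exact: hs|exact: hs]; congr Ex; apply/funext => w.
  rewrite !(updE _ (fun h j => h (x j w))) big_cons fab; ring.
have updIH (h : I -> R -> R) : (forall i, measurable_fun setT (h i)) ->
  (forall i y, 0 <= h i y) -> (forall i, has_moments P (fun w => h i (x i w))) ->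
  Ex P (fun w => (\prod_(j <- s1) f j (x j w)) *
      \prod_(j <- i :: s2) upd h j (x j w)) =
  (\prod_(i <- s1) Ex P (fun w => f i (x i w))) * (Ex P (fun w => h i (x i w)) *
    \prod_(i <- s2) Ex P (fun w => g i (x i w))).
  move=> mh h0 hh; rewrite IH//.
  - by rewrite (updE _ (fun h j => Ex P (fun w => h (x j w)))).
  - by move=> j; rewrite /upd; case: ifP.
  - by move=> j y; rewrite /upd; case: ifP.
  - by move=> j; rewrite /upd; case: ifP => // /eqP ->.
rewrite !updIH// big_cons.
have -> : Ex P (fun w => f i (x i w)) = Ex P (fun w => a i (x i w)) - Ex P (fun w => b i (x i w)).
  by rewrite -ExB//; congr Ex; apply/funext => w.
ring.
Qed.

End independence.

Section wick.
Context d (T : measurableType d) (R : realType) (P : probability T R).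

(** This recursion (integration by parts for the Gaussian density) determines every
    mixed moment, so that it serves as the definition of a family of independent
    standard Gaussians as far as polynomials are concerned. *)
Definition wick (I : eqType) (z : I -> T -> R) :=
  (forall i, has_moments P (z i)) /\
  forall b l, Ex P (fun w => z b w * \prod_(a <- l) z a w) =
    (count_mem b l)%:R * Ex P (fun w => \prod_(a <- rem b l) z a w).

Lemma iid_wick (I : choiceType) (x : I -> {RV P >-> R}) :
  iid_std_normal x -> wick (fun i => x i : T -> R).
Proof.
move=> [ind law]; have hx i := has_moments_std_normal (law i).
split=> // b l0.
pose m (l : seq I) i := gauss_mom R (count_mem i l).
have prodE (s l : seq I) : uniq s -> {subset l <= s} ->
    Ex P (fun w => \prod_(a <- l) x a w) = \prod_(i <- s) m l i.
  move=> us ls; have -> : (fun w => \prod_(a <- l) x a w) =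
      (fun w => (\prod_(i <- s) x i w ^+ count_mem i l) * \prod_(i <- [::]) (fun=> 1 : R) (x i w)).
    apply/funext => w; rewrite big_nil mulr1.
    elim: l ls => [|a l IH] ls /=.
      by rewrite big_nil big1// => i _; rewrite expr0.
    have as_ : a \in s by apply: ls; rewrite mem_head.
    rewrite big_cons IH; last by move=> i il; apply: ls; rewrite inE il orbT.
    under [RHS]eq_bigr do rewrite exprD; rewrite big_split/=; congr (_ * _).
    rewrite (bigD1_seq a)//= eqxx expr1 big1 ?mulr1// => i.
    by rewrite eq_sym => /negbTE ->; rewrite expr0.
  have hmon (c : I -> R -> R) : (forall i, measurable_fun setT (c i)) ->
      (forall i y, `|c i y| <= `|y ^+ count_mem i l|) ->
      forall i, has_moments P (fun w => c i (x i w)).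
    move=> mc lec i; apply: le_has_moments (has_momentsX (count_mem i l) (hx i)) => //.
    exact: (measurableT_comp (mc i)).
  rewrite (@Ex_prod_indep _ _ _ _ _ x ind s [::] (fun i y => y ^+ count_mem i l)
    (fun i => expr_pos (count_mem i l)) (fun i => expr_neg (count_mem i l))
    (fun _ _ => 1)).
  - rewrite big_nil mulr1; apply: eq_bigr => i _.
    exact: (Ex_std_normalX (law i)).
  - by rewrite cats0.
  - by move=> i y; exact: expr_posneg.
  - by move=> i; exact: measurable_expr_pos.
  - by move=> i y; exact: expr_pos_ge0.
  - apply: (hmon (fun i => expr_pos (count_mem i l))) => [i|i y];
      [exact: measurable_expr_pos|exact: expr_pos_le].
  - by move=> i; exact: measurable_expr_neg.
  - by move=> i y; exact: expr_neg_ge0.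
  - apply: (hmon (fun i => expr_neg (count_mem i l))) => [i|i y];
      [exact: measurable_expr_neg|exact: expr_neg_le].
  - by move=> i; exact: measurable_cst.
  - by [].
  - by move=> i; exact: has_moments_cst.
pose s := undup (b :: l0).
have us : uniq s by exact: undup_uniq.
have bs : b \in s by rewrite mem_undup mem_head.
(* only the exponent of x b changes; with c = count_mem b l0, its moment satisfies
   gauss_mom (c + 1) = c * gauss_mom (c - 1) *)
have -> : (fun w => x b w * \prod_(a <- l0) x a w) = (fun w => \prod_(a <- b :: l0) x a w).
  by apply/funext => w; rewrite big_cons.
rewrite (prodE s)//; last by move=> i; rewrite mem_undup.
rewrite (prodE s)//; last first.
  by move=> i /mem_rem il; rewrite mem_undup inE il orbT.
rewrite (bigD1_seq b)//= [in RHS](bigD1_seq b)//= mulrA; congr (_ * _).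
  rewrite /m /= eqxx add1n gauss_mom_rec; congr (_ * gauss_mom R _).
  rewrite count_rem; case: (boolP (b \in l0)) => [_|/count_memPn ->] /=; by rewrite ?eqxx ?subn1.
apply: eq_bigr => i ib; rewrite /m /= eq_sym (negbTE ib) add0n.
by rewrite count_rem /= eq_sym (negbTE ib) andbF subn0.
Qed.
End wick.

(** * Linear forms in Gaussians *)

Section linear_forms.
Context d (T : measurableType d) (R : realType) (P : probability T R).
Variables (V : finType) (y : V -> T -> R).
Hypothesis wy : wick P y.

Definition dot (a b : V -> R) : R := \sum_k a k * b k.
Definition lin (a : V -> R) (w : T) : R := \sum_k a k * y k w.

Let hy k : has_moments P (y k). Proof. by case: wy. Qed.

Lemma has_moments_lin a : has_moments P (lin a).
Proof. by apply: has_moments_sum => k _; apply: has_momentsZ. Qed.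
Hint Resolve has_moments_lin : core.

Let e k : V -> R := fun j => (j == k)%:R.

Let dot_e a k : dot a (e k) = a k.
Proof.
rewrite /dot (bigD1 k)//= /e eqxx mulr1 big1 ?addr0// => j /negbTE jk.
by rewrite jk mulr0.
Qed.

Let lin_e k : lin (e k) = y k.
Proof.
apply/funext => w; rewrite /lin (bigD1 k)//= /e eqxx mul1r big1 ?addr0// => j /negbTE jk.
by rewrite jk mul0r.
Qed.

Definition prodl (s : seq (V -> R)) (w : T) := \prod_(v <- s) lin v w.

(** The directional derivative of prodl s along c. *)
Fixpoint dprodl (c : V -> R) (s : seq (V -> R)) (w : T) : R :=
  if s is v :: s' then dot c v * prodl s' w + lin v w * dprodl c s' w else 0.

Let hprodl s : has_moments P (prodl s).
Proof. by apply: has_moments_prod. Qed.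

Let hdprodl c s : has_moments P (dprodl c s).
Proof.
elim: s => [|v s IH] /=; first exact: has_moments_cst.
by apply: has_momentsD; [exact: has_momentsZ|exact: has_momentsM].
Qed.

Let prodl_lin s1 v s2 w :
  prodl (s1 ++ v :: s2) w = \sum_k v k * prodl (s1 ++ e k :: s2) w.
Proof.
rewrite /prodl big_cat big_cons /= {2}/lin mulr_suml mulr_sumr.
by apply: eq_bigr => k _; rewrite big_cat big_cons /= lin_e; ring.
Qed.

Let dprodl_lin c s1 v s2 w :
  dprodl c (s1 ++ v :: s2) w = \sum_k v k * dprodl c (s1 ++ e k :: s2) w.
Proof.
elim: s1 => [|u s1 IH] /=.
  under eq_bigr do rewrite mulrDr; rewrite big_split /= mulr_suml; congr (_ + _).
    by apply: eq_bigr => k _; rewrite dot_e; ring.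
  rewrite /lin mulr_suml; apply: eq_bigr => k _.
  by rewrite -[X in _ = _ * (X * _)]/(lin (e k) w) lin_e; ring.
rewrite prodl_lin IH; under [RHS]eq_bigr do rewrite mulrDr.
rewrite big_split /= !mulr_sumr; congr (_ + _); apply: eq_bigr => k _; ring.
Qed.

Let dprodl_suml c s w : dprodl c s w = \sum_k c k * dprodl (e k) s w.
Proof.
elim: s => [|v s IH] /=; first by rewrite big1// => k _; rewrite mulr0.
under eq_bigr do rewrite mulrDr; rewrite big_split /= IH mulr_sumr.
congr (_ + _); last by apply: eq_bigr => k _; ring.
rewrite /dot mulr_suml; apply: eq_bigr => k _.
rewrite -[\sum_j _ * _]/(dot (e k) v) (_ : dot (e k) v = v k); first ring.
by rewrite -[RHS]dot_e /dot; apply: eq_bigr => j _; rewrite mulrC.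
Qed.

(** Only the occurrences of u b have a nonzero derivative along c. *)
Let dprodl_map (I : eqType) (u : I -> V -> R) c b :
  (forall a, dot c (u a) = (a == b)%:R) -> forall l w,
  dprodl c (map u l) w = (count_mem b l)%:R * prodl (map u (rem b l)) w.
Proof.
move=> cu; elim=> [|a l IH] w /=; first by rewrite mul0r.
rewrite cu IH; case: eqP => [->|_] /=; last first.
  by rewrite mul0r !add0r add0n /prodl big_cons; ring.
rewrite natrD mulrDl; congr (_ + _).
have [bl|/count_memPn ->] := boolP (b \in l); last by rewrite !mul0r mulr0.
rewrite mulrCA; congr (_ * _).
by rewrite /prodl !big_map [RHS](perm_big _ (perm_to_rem bl)) big_cons.
Qed.

(** Stein's identity. For products of coordinates it is the Wick recursion; both
    sides are linear in every form. *)
Lemma stein c s : Ex P (fun w => lin c w * prodl s w) = Ex P (dprodl c s).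
Proof.
have ebase k t s1 :
    Ex P (fun w => y k w * prodl (s1 ++ map e t) w) = Ex P (dprodl (e k) (s1 ++ map e t)).
  (* the forms of s1 are expanded on the basis one by one, starting from the last *)
  elim/last_ind: s1 t => [|s1 v IH] t.
    have dual a : dot (e k) (e a) = (a == k)%:R by rewrite dot_e.
    have pE l w : prodl (map e l) w = \prod_(a <- l) y a w.
      by rewrite /prodl big_map; apply: eq_bigr => a _; rewrite lin_e.
    under eq_fun do rewrite pE.
    have [_ ->] := wy; rewrite -ExZ; last exact: has_moments_prod.
    by apply: eq_Ex => w; rewrite /= (dprodl_map dual) pE.
  rewrite cat_rcons; under eq_fun do rewrite prodl_lin mulr_sumr.
  rewrite [RHS](eq_Ex _ (dprodl_lin _ _ _ _)) !Ex_sum; last 2 first.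
  - by move=> j _; apply: has_momentsZ.
  - by move=> j _; apply: has_momentsM => //; exact: has_momentsZ.
  apply: eq_bigr => j _; rewrite ExZ// -(IH (j :: t)) -ExZ; last exact: has_momentsM.
  by congr Ex; apply/funext => w; rewrite /=; ring.
rewrite [RHS](eq_Ex _ (dprodl_suml _ _)).
under eq_fun do rewrite /lin mulr_suml.
rewrite !Ex_sum; last 2 first.
- by move=> j _; apply: has_momentsZ.
- by move=> j _; apply: has_momentsM => //; exact: has_momentsZ.
apply: eq_bigr => k _; rewrite ExZ//.
have := ebase k [::] s; rewrite cats0 => <-.
rewrite -ExZ; last exact: has_momentsM.
by congr Ex; apply/funext => w; ring.
Qed.

Definition orthonormal_family (I : eqType) (u : I -> V -> R) :=
  forall i j, dot (u i) (u j) = (i == j)%:R.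

(** Rotation invariance: Stein's identity sees the forms only through their scalar
    products. *)
Lemma wick_lin (I : eqType) (u : I -> V -> R) :
  orthonormal_family u -> wick P (fun i => lin (u i)).
Proof.
move=> ou; split=> // b l.
have dual a : dot (u b) (u a) = (a == b)%:R by rewrite ou eq_sym.
have pE s w : prodl (map u s) w = \prod_(a <- s) lin (u a) w by rewrite /prodl big_map.
under eq_fun do rewrite -pE; rewrite stein.
rewrite -ExZ; last exact: has_moments_prod.
by apply: eq_Ex => w; rewrite (dprodl_map dual) pE.
Qed.

(** In Stein's identity along r, the u's have derivative zero and only lin b is
    differentiated. *)
Lemma stein_orth (I : eqType) (u : I -> V -> R) r b (l : seq I) :
  (forall i, dot r (u i) = 0) ->
  Ex P (fun w => lin r w * lin b w * \prod_(i <- l) lin (u i) w) =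
  dot r b * Ex P (fun w => \prod_(i <- l) lin (u i) w).
Proof.
move=> ru; rewrite -ExZ; last exact: has_moments_prod.
have := stein r (b :: map u l).
have d0 w : dprodl r (map u l) w = 0.
  by elim: l => //= a l ->; rewrite ru mul0r mulr0 addr0.
rewrite (_ : dprodl _ _ = (fun w => dot r b * \prod_(i <- l) lin (u i) w)); last first.
  by apply/funext => w /=; rewrite d0 mulr0 addr0 /prodl big_map.
move=> <-; congr Ex; apply/funext => w.
by rewrite /prodl big_cons big_map mulrA.
Qed.

End linear_forms.

Section gauss_poly.
Context (R : realType).
Implicit Types p q : {poly R}.

(** The expectation of p at a standard Gaussian variable. *)
Definition gaussE p : R := \sum_(k < size p) p`_k * gauss_mom R k.

Lemma gaussE_wide n p : (size p <= n)%N -> gaussE p = \sum_(k < n) p`_k * gauss_mom R k.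
Proof.
move=> pn; rewrite /gaussE (big_ord_widen _ (fun k => p`_k * gauss_mom R k) pn).
rewrite [RHS](bigID (fun k : 'I_n => (k < size p)%N)) /= [X in _ = _ + X]big1 ?addr0// => k.
by rewrite -leqNgt => /(nth_default 0) ->; rewrite mul0r.
Qed.

Lemma gaussED p q : gaussE (p + q) = gaussE p + gaussE q.
Proof.
pose n := maxn (size p) (size q).
rewrite (@gaussE_wide n (p + q)) ?size_polyD// (@gaussE_wide n p) ?leq_maxl//.
rewrite (@gaussE_wide n q) ?leq_maxr// -big_split; apply: eq_bigr => k _.
by rewrite coefD mulrDl.
Qed.

Lemma gaussEZ a p : gaussE (a *: p) = a * gaussE p.
Proof.
rewrite (@gaussE_wide (size p) (a *: p)) ?size_scale_leq// /gaussE mulr_sumr.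
by apply: eq_bigr => k _; rewrite coefZ mulrA.
Qed.

Lemma gaussE0 : gaussE 0 = 0.
Proof. by rewrite /gaussE size_poly0 big_ord0. Qed.

Lemma gaussE_sum (I : Type) (s : seq I) (Q : pred I) (F : I -> {poly R}) :
  gaussE (\sum_(i <- s | Q i) F i) = \sum_(i <- s | Q i) gaussE (F i).
Proof. exact: (big_morph gaussE gaussED gaussE0). Qed.

Lemma gaussEXn k : gaussE 'X^k = gauss_mom R k.
Proof.
rewrite /gaussE size_polyXn (bigD1 ord_max)//= coefXn eqxx mul1r big1 ?addr0// => i.
by rewrite -val_eqE /= => /negbTE ik; rewrite coefXn ik mul0r.
Qed.

Lemma gaussE1 : gaussE 1 = 1.
Proof. by have := gaussEXn 0; rewrite expr0 gauss_mom0. Qed.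

Lemma gaussEX_deriv p : gaussE ('X * p) = gaussE p^`().
Proof.
rewrite -(coefK p) poly_def mulr_sumr (raddf_sum (@deriv R)) !gaussE_sum; apply: eq_bigr => i _.
rewrite -scalerAr /= derivZ !gaussEZ -exprS gaussEXn derivXn.
by rewrite -scaler_nat gaussEZ gaussEXn gauss_mom_rec.
Qed.

End gauss_poly.

Section wick_poly.
Context d (T : measurableType d) (R : realType) (P : probability T R).
Variables (I : eqType) (z : I -> T -> R).
Hypothesis wz : wick P z.

Let hz i : has_moments P (z i). Proof. by case: wz. Qed.
Let hp (l : seq I) : has_moments P (fun w => \prod_(a <- l) z a w).
Proof. exact: has_moments_prod. Qed.

Let Ex_expand (f : {poly R}) i H : has_moments P H ->
  Ex P (fun w => f.[z i w] * H w) = \sum_(k < size f) f`_k * Ex P (fun w => z i w ^+ k * H w).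
Proof.
move=> hH; under eq_fun do rewrite horner_coef mulr_suml.
rewrite Ex_sum => [|k _]; last first.
  by apply: has_momentsM => //; apply/has_momentsZ/has_momentsX.
apply: eq_bigr => k _; rewrite -ExZ; last by apply: has_momentsM => //; exact: has_momentsX.
by congr Ex; apply/funext => w; rewrite mulrA.
Qed.

Let prod_nseq k i l w :
  z i w ^+ k * \prod_(a <- l) z a w = \prod_(a <- nseq k i ++ l) z a w.
Proof. by rewrite big_cat big_nseq iter_mulr_1. Qed.

Let Ex_power k i l : i \notin l ->
  Ex P (fun w => z i w ^+ k * \prod_(a <- l) z a w) =
  gauss_mom R k * Ex P (fun w => \prod_(a <- l) z a w).
Proof.
move=> il; have cl : count_mem i l = 0%N by apply/count_memPn.
suff [] : (Ex P (fun w => z i w ^+ k * \prod_(a <- l) z a w) =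
    gauss_mom R k * Ex P (fun w => \prod_(a <- l) z a w)) /\
  (Ex P (fun w => z i w ^+ k.+1 * \prod_(a <- l) z a w) =
    gauss_mom R k.+1 * Ex P (fun w => \prod_(a <- l) z a w)) by [].
have step j : Ex P (fun w => z i w ^+ j.+1 * \prod_(a <- l) z a w) =
    j%:R * Ex P (fun w => z i w ^+ j.-1 * \prod_(a <- l) z a w).
  under eq_fun do rewrite exprS -mulrA prod_nseq.
  have [_ ->] := wz; rewrite count_cat count_nseq /= eqxx mul1n cl addn0.
  case: j => [|j]; first by rewrite !mul0r.
  by congr (_ * _); congr Ex; apply/funext => w; rewrite prod_nseq /= eqxx.
elim: k => [|k [IH0 IH1]]; split => //.
- by under eq_fun do rewrite expr0 mul1r; rewrite gauss_mom0 mul1r.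
- by rewrite step gauss_mom1 !mul0r.
- by rewrite step /= IH0 gauss_mom_rec mulrA.
Qed.

(** Independence at the level of polynomials; the extra monomial, in the remaining
    variables, makes the induction on s possible. *)
Lemma Ex_prod_poly (s l : seq I) (f : I -> {poly R}) :
  uniq s -> {in l, forall a, a \notin s} ->
  Ex P (fun w => (\prod_(i <- s) (f i).[z i w]) * \prod_(a <- l) z a w) =
  (\prod_(i <- s) gaussE (f i)) * Ex P (fun w => \prod_(a <- l) z a w).
Proof.
elim: s l => [|i s IH] l.
  by move=> _ _; rewrite big_nil mul1r; under eq_fun do rewrite big_nil mul1r.
rewrite cons_uniq => /andP[is_ us] ls.
have il : i \notin l by apply/negP => /ls; rewrite mem_head.
have hs : has_moments P (fun w => \prod_(i <- s) (f i).[z i w]).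
  by apply: has_moments_prod => j _; exact: has_moments_horner.
under eq_fun do rewrite big_cons -mulrA; rewrite Ex_expand; last exact: has_momentsM.
rewrite big_cons /gaussE mulr_suml mulr_suml; apply: eq_bigr => k _.
rewrite -!mulrA; congr (_ * _).
under eq_fun do rewrite mulrCA prod_nseq; rewrite IH//; last first.
  move=> a; rewrite mem_cat mem_nseq => /orP[/andP[_ /eqP ->//]|al].
  by have := ls a al; rewrite inE negb_or => /andP[].
rewrite mulrCA; congr (_ * _).
by rewrite -(Ex_power k il); congr Ex; apply/funext => w; rewrite prod_nseq.
Qed.

(** Products of polynomials in the z's are combinations of monomials, on which
    the two expectations agree. *)
Lemma Ex_test (F G : T -> R) (s : seq I) (f : I -> {poly R}) :
  has_moments P F -> has_moments P G ->
  (forall l, Ex P (fun w => F w * \prod_(a <- l) z a w) =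
             Ex P (fun w => G w * \prod_(a <- l) z a w)) ->
  Ex P (fun w => F w * \prod_(i <- s) (f i).[z i w]) =
  Ex P (fun w => G w * \prod_(i <- s) (f i).[z i w]).
Proof.
move=> hF hG FG.
have hs s' : has_moments P (fun w => \prod_(i <- s') (f i).[z i w]).
  by apply: has_moments_prod => j _; exact: has_moments_horner.
suff gen l : Ex P (fun w => F w * ((\prod_(i <- s) (f i).[z i w]) * \prod_(a <- l) z a w)) =
    Ex P (fun w => G w * ((\prod_(i <- s) (f i).[z i w]) * \prod_(a <- l) z a w)).
  have := gen [::]; under eq_fun do rewrite big_nil mulr1.
  by move=> ->; under eq_fun do rewrite big_nil mulr1.
elim: s l => [|i s IH] l.
  under eq_fun do rewrite big_nil mul1r.
  by under [in RHS]eq_fun do rewrite big_nil mul1r.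
have E H : has_moments P H ->
    Ex P (fun w => H w *
      ((\prod_(j <- i :: s) (f j).[z j w]) * \prod_(a <- l) z a w)) =
    \sum_(k < size (f i)) (f i)`_k * Ex P (fun w => H w *
      ((\prod_(j <- s) (f j).[z j w]) * \prod_(a <- nseq k i ++ l) z a w)).
  move=> hH; under eq_fun do rewrite big_cons -mulrA mulrCA.
  rewrite Ex_expand; last by apply: has_momentsM => //; exact: has_momentsM.
  apply: eq_bigr => k _; congr (_ * Ex P _); apply/funext => w.
  by rewrite -prod_nseq; ring.
by rewrite !E//; apply: eq_bigr => k _; rewrite IH.
Qed.

End wick_poly.

(** * Polynomial weights *)

Section gaussian_weights.
Context d (T : measurableType d) (R : realType) (P : probability T R).
Variables (V : finType) (y : V -> T -> R).
Hypothesis wy : wick P y.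
Variable q : {poly R}.
Hypothesis q1 : gaussE q = 1.
Hypothesis qX : gaussE (q * 'X) = 0.
Local Notation lin := (lin y).

Let hlin a : has_moments P (lin a). Proof. exact: has_moments_lin. Qed.

Lemma Ex_prod_lin (I : finType) (u : I -> V -> R) (f : I -> {poly R}) :
  orthonormal_family u ->
  Ex P (fun w => \prod_i (f i).[lin (u i) w]) = \prod_i gaussE (f i).
Proof.
move=> ou; have nil : {in [::], forall a : I, a \notin index_enum I} by [].
have := Ex_prod_poly (wick_lin wy ou) f (index_enum_uniq I) nil.
rewrite [X in _ * X](eq_Ex _ (g := fun=> 1)) ?Ex_cst => [|w]; last by rewrite big_nil.
by rewrite mulr1 => <-; apply: eq_Ex => w; rewrite big_nil mulr1.
Qed.

Section energy.
Variables (I : finType) (u : I -> V -> R).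
Hypothesis ou : orthonormal_family u.

Definition weight w : R := \prod_i q.[lin (u i) w].

Lemma has_moments_weight : has_moments P weight.
Proof. by apply: has_moments_prod => i _; exact: has_moments_horner. Qed.

Let Ex_prod (f : I -> {poly R}) :
  Ex P (fun w => \prod_i (f i).[lin (u i) w]) = \prod_i gaussE (f i).
Proof.
exact: Ex_prod_lin.
Qed.

Lemma Ex_weight : Ex P weight = 1.
Proof. by rewrite /weight Ex_prod big1. Qed.

Let Ex_weightM i j : Ex P (fun w => weight w * (lin (u i) w * lin (u j) w)) =
  (i == j)%:R * gaussE (q * 'X^2).
Proof.
pose f k := q * 'X^((k == i) + (k == j)).
have -> : Ex P (fun w => weight w * (lin (u i) w * lin (u j) w)) =
    Ex P (fun w => \prod_k (f k).[lin (u k) w]).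
  apply: eq_Ex => w; rewrite /weight.
  under [RHS]eq_bigr => k _ do rewrite /f exprD mulrA !hornerM !hornerXn -mulrA.
  rewrite big_split big_split /=; congr (_ * (_ * _)).
    rewrite (bigD1 i)//= eqxx expr1 big1 ?mulr1// => k /negbTE ->.
    by rewrite expr0.
  rewrite (bigD1 j)//= eqxx expr1 big1 ?mulr1// => k /negbTE ->.
  by rewrite expr0.
rewrite Ex_prod (bigD1 i)//= /f eqxx; have [<-|ij] := eqVneq i j.
  rewrite mul1r big1 ?mulr1// => k /negbTE ki.
  by rewrite ki expr0 mulr1.
by rewrite addn0 expr1 qX !mul0r.
Qed.

(** The part of a form in the span of the u's is damped by the weight; the
    orthogonal part is not affected. *)
Lemma Ex_weight_sqr a : Ex P (fun w => weight w * lin a w ^+ 2) =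
  dot a a - (1 - gaussE (q * 'X^2)) * \sum_i dot a (u i) ^+ 2.
Proof.
(* a = pr + r, with pr in the span of the u's and r orthogonal to it *)
pose c i := dot a (u i); pose C := \sum_i c i ^+ 2.
pose pr k := \sum_i c i * u i k; pose r k := a k - pr k.
have linpr w : lin pr w = \sum_i c i * lin (u i) w.
  rewrite /lin /pr; under eq_bigr do rewrite mulr_suml.
  rewrite exchange_big; apply: eq_bigr => i _; rewrite mulr_sumr.
  by apply: eq_bigr => k _; rewrite mulrA.
have dotpr b : dot b pr = \sum_i c i * dot b (u i).
  rewrite /dot /pr; under eq_bigr do rewrite mulr_sumr.
  rewrite exchange_big; apply: eq_bigr => i _; rewrite mulr_sumr.
  by apply: eq_bigr => k _; ring.
have dotC b b' : dot b b' = dot b' b.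
  by rewrite /dot; apply: eq_bigr => k _; rewrite mulrC.
have dotr b : dot r b = dot a b - dot pr b.
  by rewrite /dot -sumrB; apply: eq_bigr => k _; rewrite /r mulrBl.
have ru i : dot r (u i) = 0.
  rewrite dotr [dot pr _]dotC dotpr (bigD1 i)//= ou eqxx mulr1 big1 ?addr0 ?subrr// => j ji.
  by rewrite ou eq_sym (negbTE ji) mulr0.
have linr w : lin r w = lin a w - lin pr w.
  by rewrite /lin -sumrB; apply: eq_bigr => k _; rewrite /r mulrBl.
pose b k := a k + pr k.
have linb w : lin b w = lin a w + lin pr w.
  by rewrite /lin -big_split; apply: eq_bigr => k _; rewrite /b mulrDl.
have dotrb : dot r b = dot a a - C.
  have rp : dot r pr = 0 by rewrite dotpr big1// => i _; rewrite ru mulr0.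
  have -> : dot r b = dot r a + dot r pr.
    by rewrite /dot -big_split; apply: eq_bigr => k _; rewrite /b mulrDr.
  by rewrite rp addr0 dotr [dot pr _]dotC dotpr.
have hw := has_moments_weight.
have -> : Ex P (fun w => weight w * lin a w ^+ 2) =
    Ex P (fun w => weight w * (lin r w * lin b w)) + Ex P (fun w => weight w * lin pr w ^+ 2).
  rewrite -ExD; last 2 first.
  - by apply: has_momentsM => //; exact: has_momentsM.
  - by apply: has_momentsM => //; exact: has_momentsX.
  by apply: eq_Ex => w; rewrite linr linb; ring.
(* lin r * lin b acts as the constant dot r b against polynomials in the u's *)
have -> : Ex P (fun w => weight w * (lin r w * lin b w)) = dot a a - C.
  rewrite -dotrb; transitivity (Ex P (fun w => dot r b * weight w)).
    have := @Ex_test _ _ _ P _ _ (wick_lin wy ou) (fun w => lin r w * lin b w)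
      (fun=> dot r b) (index_enum I) (fun=> q).
    move=> <-; first by apply: eq_Ex => w; rewrite mulrC.
    - exact: has_momentsM.
    - exact: has_moments_cst.
    move=> l; rewrite stein_orth// ExZ//.
    by apply: has_moments_prod => i _.
  by rewrite ExZ// Ex_weight mulr1.
have -> : Ex P (fun w => weight w * lin pr w ^+ 2) = gaussE (q * 'X^2) * C.
  have -> : Ex P (fun w => weight w * lin pr w ^+ 2) =
     Ex P (fun w => \sum_i \sum_j (c i * c j) * (weight w * (lin (u i) w * lin (u j) w))).
    apply: eq_Ex => w; rewrite linpr expr2 mulr_suml mulr_sumr; apply: eq_bigr => i _.
    by rewrite mulr_sumr mulr_sumr; apply: eq_bigr => j _; ring.
  have hij i j : has_moments P (fun w => weight w * (lin (u i) w * lin (u j) w)).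
    by apply: has_momentsM => //; exact: has_momentsM.
  rewrite Ex_sum => [|i _]; last by apply: has_moments_sum => j _; exact: has_momentsZ.
  rewrite /C mulr_sumr; apply: eq_bigr => i _.
  rewrite Ex_sum => [|j _]; last exact: has_momentsZ.
  rewrite (bigD1 i)//= big1 ?addr0 => [|j ji].
    by rewrite ExZ// Ex_weightM eqxx mul1r mulrC.
  by rewrite ExZ// Ex_weightM eq_sym (negbTE ji) mul0r mulr0.
rewrite -/C; ring.
Qed.

End energy.

(** Weights attached to mutually orthogonal blocks are independent, so that
    their average concentrates. *)
Lemma weight_average_var (J K : finType) (u : J * K -> V -> R) :
  orthonormal_family u -> (0 < #|J|)%N ->
  Ex P (fun w => (1 - #|J|%:R^-1 * \sum_j weight (fun k => u (j, k)) w) ^+ 2) <=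
    gaussE (q ^+ 2) ^+ #|K| / #|J|%:R.
Proof.
move=> ou J0; set c := #|J|%:R^-1; set W := fun j => weight (fun k => u (j, k)).
have cJ : c * #|J|%:R = 1 by rewrite mulVf// pnatr_eq0 -lt0n.
have hW j : has_moments P (W j) by exact: has_moments_weight.
have ouj j : orthonormal_family (fun k => u (j, k)).
  by move=> k k'; rewrite ou xpair_eqE eqxx.
have EW j : Ex P (W j) = 1 by apply: Ex_weight; exact: ouj.
have EWW i j : Ex P (fun w => W i w * W j w) =
    if i == j then gaussE (q ^+ 2) ^+ #|K| else 1.
  have -> : Ex P (fun w => W i w * W j w) =
      Ex P (fun w => \prod_p (q ^+ ((p.1 == i) + (p.1 == j))).[lin (u p) w]).
    apply: eq_Ex => w; rewrite (eq_bigr (fun p : J * K =>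
      (q ^+ ((p.1 == i) + (p.1 == j))).[lin (u (p.1, p.2)) w])); last by case.
    rewrite -(pair_bigA _ (fun a k =>
      (q ^+ ((a == i) + (a == j))).[lin (u (a, k)) w])) /=.
    under [RHS]eq_bigr => a _ do
      under eq_bigr => k _ do rewrite exprD hornerM.
    under [RHS]eq_bigr => a _ do rewrite big_split /=.
    rewrite big_split /=; congr (_ * _).
      rewrite (bigD1 i)//= eqxx expr1 [X in _ * X]big1 ?mulr1// => k /negbTE ->.
      by rewrite big1// => k' _; rewrite expr0 hornerC.
    rewrite (bigD1 j)//= eqxx expr1 [X in _ * X]big1 ?mulr1// => k /negbTE ->.
    by rewrite big1// => k' _; rewrite expr0 hornerC.
  rewrite (Ex_prod_lin (fun p => q ^+ ((p.1 == i) + (p.1 == j))) ou).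
  rewrite -(pair_bigA _ (fun a k => gaussE (q ^+ ((a == i) + (a == j))))) /=.
  under eq_bigr do rewrite prodr_const.
  have [<-|ij] := eqVneq i j.
    rewrite (bigD1 i)//= eqxx big1 ?mulr1// => a /negbTE ->.
    by rewrite expr0 gaussE1 expr1n.
  rewrite big1// => a _; have [->|ai] := eqVneq a i.
    by rewrite (negbTE ij) expr1 q1 expr1n.
  by case: eqP => _; rewrite ?expr0 ?expr1 ?gaussE1 ?q1 expr1n.
set g := gaussE (q ^+ 2) ^+ #|K| in EWW *.
pose S w := c * \sum_j W j w.
have hS : has_moments P S by apply: has_momentsZ; exact: has_moments_sum.
have ES : Ex P S = 1.
  rewrite /S ExZ; last exact: has_moments_sum.
  by rewrite Ex_sum// (eq_bigr (fun=> 1))// sumr_const.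
have ES2 : Ex P (fun w => S w ^+ 2) <= 1 + c * g.
  have -> : Ex P (fun w => S w ^+ 2) = c ^+ 2 * \sum_i \sum_j Ex P (fun w => W i w * W j w).
    have -> : Ex P (fun w => S w ^+ 2) = Ex P (fun w => c ^+ 2 * \sum_i \sum_j W i w * W j w).
      apply: eq_Ex => w; rewrite /S exprMn; congr (_ * _).
      by rewrite expr2 mulr_suml; apply: eq_bigr => i _; rewrite mulr_sumr.
    have hWW i j : has_moments P (fun w => W i w * W j w) by exact: has_momentsM.
    rewrite ExZ; last by apply: has_moments_sum => i _; exact: has_moments_sum.
    rewrite Ex_sum => [|i _]; last exact: has_moments_sum.
    by congr (_ * _); apply: eq_bigr => i _; rewrite Ex_sum.
  have row i : \sum_j Ex P (fun w => W i w * W j w) <= g + #|J|%:R.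
    under eq_bigr do rewrite EWW.
    rewrite (bigD1 i)//= eqxx lerD2l (eq_bigr (fun=> 1)) => [|j]; last first.
      by rewrite eq_sym => /negbTE ->.
    by rewrite sumr_const ler_nat max_card.
  have : \sum_i \sum_j Ex P (fun w => W i w * W j w) <= (g + #|J|%:R) *+ #|J|.
    by rewrite -sumr_const; apply: ler_sum => i _; exact: row.
  move=> le_sum; apply: le_trans (ler_wpM2l (sqr_ge0 _) le_sum) _.
  rewrite -mulr_natr expr2.
  rewrite (_ : c * c * _ = c * #|J|%:R * (c * #|J|%:R + c * g)); last by ring.
  by rewrite cJ mul1r.
have -> : Ex P (fun w => (1 - c * \sum_j W j w) ^+ 2) =
    Ex P (fun=> 1) - 2 * Ex P S + Ex P (fun w => S w ^+ 2).
  rewrite -ExZ// -ExB; [|exact: has_moments_cst|exact: has_momentsZ].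
  rewrite -ExD; [|apply: has_momentsB; [exact: has_moments_cst|exact: has_momentsZ]
                 |exact: has_momentsX].
  by apply: eq_Ex => w; rewrite -/(S w); ring.
rewrite Ex_cst ES mulrC -/c; lra.
Qed.

End gaussian_weights.

(** * A weight concentrated near the origin *)

Section hermite.
Context (R : realType).
Implicit Types p q : {poly R}.
Local Notation gaussE := (@gaussE R).

Fixpoint hermite n : {poly R} :=
  if n is n'.+1 then 'X * hermite n' - (hermite n')^`() else 1.
Arguments hermite : simpl never.

Lemma hermite0 : hermite 0 = 1. Proof. by []. Qed.

Lemma hermiteS n : hermite n.+1 = 'X * hermite n - (hermite n)^`().
Proof. by []. Qed.

Lemma deriv_hermite n : (hermite n)^`() = n%:R *: hermite n.-1.
Proof.
elim: n => [|n IH]; first by rewrite hermite0 derivC scale0r.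
rewrite hermiteS derivB derivM derivX mul1r {2}IH IH derivZ -addrA.
rewrite -scalerAr -scalerBr; case: n {IH} => [|n].
  by rewrite scale0r addr0 scale1r.
by rewrite -hermiteS -[in RHS]add1n natrD scalerDl scale1r.
Qed.

Lemma mulX_hermite n : 'X * hermite n = hermite n.+1 + n%:R *: hermite n.-1.
Proof. by rewrite hermiteS -deriv_hermite subrK. Qed.

(** Integration by parts: multiplication by X minus differentiation is the adjoint
    of differentiation. *)
Lemma gaussE_hermite n p : gaussE (hermite n.+1 * p) = gaussE (hermite n * p^`()).
Proof.
rewrite hermiteS mulrBl -mulrA -scaleN1r gaussED gaussEZ gaussEX_deriv derivM gaussED.
by rewrite mulN1r addrAC subrr add0r.
Qed.

Lemma hermite_orth n m : gaussE (hermite n * hermite m) = (n == m)%:R * n`!%:R.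
Proof.
elim: n m => [|n IH] [|m].
- by rewrite mulr1 gaussE1 eqxx mul1r fact0.
- by rewrite mulrC gaussE_hermite derivC mulr0 gaussE0 mul0r.
- by rewrite gaussE_hermite derivC mulr0 gaussE0 mul0r.
rewrite gaussE_hermite deriv_hermite /= -scalerAr gaussEZ IH eqSS.
have [->|_] := eqVneq n m; last by rewrite !mul0r mulr0.
by rewrite !mul1r factS natrM.
Qed.

Lemma gaussE_hermite_sqr m (g : nat -> nat) (c : nat -> R) : injective g ->
  gaussE ((\sum_(k < m) c k *: hermite (g k)) ^+ 2) = \sum_(k < m) c k ^+ 2 * (g k)`!%:R.
Proof.
move=> ig; rewrite expr2 mulr_suml gaussE_sum; apply: eq_bigr => k _.
rewrite mulr_sumr gaussE_sum (bigD1 k)//= big1 ?addr0 => [|j jk].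
  by rewrite -scalerAl -scalerAr !gaussEZ hermite_orth eqxx mul1r mulrA.
rewrite -scalerAl -scalerAr !gaussEZ hermite_orth (inj_eq ig).
by rewrite (inj_eq val_inj) eq_sym (negbTE jk) mul0r !mulr0.
Qed.

(* the squared norm of He_2k / (2^k k!), which is also the k-th central binomial
   coefficient divided by 4^k; the sums below are found by telescoping *)
Let r k : R := (2 * k)`!%:R / (2 ^+ k * k`!%:R) ^+ 2.

Let den_neq0 k : 2 ^+ k * k`!%:R != 0 :> R.
Proof. by rewrite mulf_neq0 ?expf_neq0 ?pnatr_eq0// -lt0n fact_gt0. Qed.

Let r_gt0 k : 0 < r k.
Proof.
by rewrite divr_gt0 ?ltr0n ?fact_gt0// exprn_even_gt0.
Qed.

Let r_rec k : (2 * k.+1)%:R * r k.+1 = (2 * k).+1%:R * r k.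
Proof.
have -> : r k.+1 = r k * ((2 * k).+1%:R / (2 * k.+1)%:R).
  rewrite /r (_ : 2 * k.+1 = (2 * k).+2)%N; last by lia.
  rewrite !factS !natrM [2 ^+ k.+1]exprS (_ : (2 * k).+2%:R = 2 * k.+1%:R :> R); last first.
    by rewrite -natrM; congr _%:R; lia.
  have := den_neq0 k; have : k.+1%:R != 0 :> R by rewrite pnatr_eq0.
  move: (k.+1%:R : R) (k`!%:R : R) (2 ^+ k : R) => a b c a0 cb0.
  have b0 : b != 0 by apply: contraNneq cb0 => ->; rewrite mulr0.
  have c0 : c != 0 by apply: contraNneq cb0 => ->; rewrite mul0r.
  by field; rewrite ?b0 ?c0 ?a0.
by rewrite mulrCA [(2 * k.+1)%:R * _]mulrC divfK ?pnatr_eq0// mulrC.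
Qed.

Let sum_r m : \sum_(k < m) r k = (2 * m)%:R * r m.
Proof.
elim: m => [|m IH]; first by rewrite big_ord0 mul0r.
by rewrite big_ord_recr /= IH r_rec -natr1; ring.
Qed.

Let sum_odd_r m : 3 * \sum_(k < m) (2 * k).+1%:R * r k = (2 * m * (2 * m).+1)%:R * r m.
Proof.
elim: m => [|m IH]; first by rewrite big_ord0 mulr0 mul0r.
rewrite big_ord_recr /= mulrDr IH [in RHS]natrM [RHS]mulrAC r_rec.
rewrite (_ : (2 * m.+1).+1 = (2 * m).+3)%N; last by lia.
rewrite -!natr1 !natrM; ring.
Qed.

Let sum_lin_r m : \sum_(k < m) (m - k)%:R * r k = \sum_(k < m) (2 * k).+1%:R * r k.
Proof.
have E : 2 * \sum_(k < m) (m - k)%:R * r k + \sum_(k < m) (2 * k).+1%:R * r k =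
    (2 * m).+1%:R * \sum_(k < m) r k.
  rewrite mulr_sumr -big_split mulr_sumr; apply: eq_bigr => k _ /=.
  by rewrite natrB 1?ltnW// -!natr1 !natrM; ring.
have := sum_odd_r m; rewrite sum_r in E; rewrite natrM => O.
have : (2 * m).+1%:R * ((2 * m)%:R * r m) = 3 * \sum_(k < m) (2 * k).+1%:R * r k by rewrite O; ring.
rewrite -{}E; lra.
Qed.

(** The weight is the normalised square of p = sum_k (-1)^k b_k He_2k / (2^k k!).
    Since X He_n = He_(n+1) + n He_(n-1), the coefficients of X p are, up to sign, the
    differences b_k - b_(k+1): the second moment under the weight p^2 is a Dirichlet
    form of the sequence b. With b_k = n - k for k < n, it is at most 3 / (2 n + 1)
    times the total mass of p^2. *)
Lemma concentrated_weight (eps : R) : 0 < eps -> exists q,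
  [/\ forall x, 0 <= q.[x], gaussE q = 1, gaussE (q * 'X) = 0 &
      0 <= gaussE (q * 'X^2) <= eps].
Proof.
move=> eps0.
have [m em] : exists m : nat, 3 / eps <= m.+1%:R.
  exists (Num.truncn (3 / eps)); apply/ltW; exact: truncnS_gt.
set n := m.+1 in em.
pose c k : R := (-1) ^+ k * (n - k)%:R / (2 ^+ k * k`!%:R).
pose p := \sum_(k < n) c k *: hermite (2 * k).
pose A := \sum_(k < n) (n - k)%:R ^+ 2 * r k.
pose B := \sum_(k < n) (2 * k).+1%:R * r k.
have sgn2 k (z : R) : z = (-1) ^+ k ^+ 2 * z by rewrite sqrr_sign mul1r.
have pA : gaussE (p ^+ 2) = A.
  rewrite /p gaussE_hermite_sqr; last by move=> i j; lia.
  apply: eq_bigr => k _; rewrite [RHS](sgn2 k) /c /r.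
  by field; rewrite pnatr_eq0 -lt0n fact_gt0 expf_neq0.
have Xp : 'X * p = \sum_(k < n) ((-1) ^+ k / (2 ^+ k * k`!%:R)) *: hermite (2 * k).+1.
  have XpE : 'X * p = \sum_(k < n) c k *: hermite (2 * k).+1 +
      \sum_(k < n) (c k * (2 * k)%:R) *: hermite (2 * k).-1.
    rewrite /p mulr_sumr -big_split; apply: eq_bigr => k _ /=.
    by rewrite -scalerAr mulX_hermite scalerDr scalerA.
  rewrite XpE [X in _ + X]big_ord_recl muln0 mulr0 scale0r add0r.
  have -> : \sum_(k < m) (c (lift ord0 k) * (2 * lift ord0 k)%:R) *: hermite (2 * lift ord0 k).-1 =
      \sum_(k < m) (c k.+1 * (2 * k.+1)%:R) *: hermite (2 * k).+1.
    by apply: eq_bigr => k _; rewrite lift0; congr (_ *: hermite _); lia.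
  rewrite big_ord_recr [X in _ = X]big_ord_recr /= addrAC -big_split /=; congr (_ + _).
    apply: eq_bigr => k _; rewrite -scalerDl; congr (_ *: _); rewrite /c.
    have kn : (k < n)%N by apply: leq_trans (ltn_ord k) _.
    rewrite !natrB//; last by rewrite ltnW.
    rewrite -[k.+1%:R]natr1 factS exprS exprS !natrM -natr1.
    by field; rewrite pnatr_eq0 -lt0n fact_gt0 expf_neq0 //= nat1r pnatr_eq0.
  by congr (_ *: _); rewrite /c subSnn mulr1.
have XpB : gaussE (('X * p) ^+ 2) = B.
  have inj : injective (fun k => (2 * k).+1) by move=> i j; lia.
  rewrite Xp (gaussE_hermite_sqr n (fun k => (-1) ^+ k / (2 ^+ k * k`!%:R)) inj).
  apply: eq_bigr => k _; rewrite [RHS](sgn2 k) /r factS natrM.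
  by field; rewrite pnatr_eq0 -lt0n fact_gt0 expf_neq0.
have pXp : gaussE (p * ('X * p)) = 0.
  rewrite Xp /p mulr_suml gaussE_sum big1// => k _.
  rewrite mulr_sumr gaussE_sum big1// => j _.
  rewrite -scalerAl -scalerAr !gaussEZ hermite_orth (_ : _ == _ = false) ?mul0r ?mulr0//.
  by apply/negbTE; lia.
have n0 : 0 < n%:R :> R by rewrite ltr0n.
have B0 : 0 < B.
  rewrite /B big_ord_recl ltr_wpDr ?mulr_gt0// sumr_ge0// => k _.
  by rewrite mulr_ge0// ltW.
(* Cauchy-Schwarz between n - k and 1, in the form of a nonnegative square; t is the
   ratio of B to the sum of the r k *)
have AB : (2 * n).+1%:R / 3 * B <= A.
  pose t : R := (2 * n).+1%:R / 3.
  have : 0 <= \sum_(k < n) ((n - k)%:R - t) ^+ 2 * r k.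
    by apply: sumr_ge0 => k _; rewrite mulr_ge0 ?sqr_ge0// ltW.
  have -> : \sum_(k < n) ((n - k)%:R - t) ^+ 2 * r k =
      A - 2 * t * B + t ^+ 2 * \sum_(k < n) r k.
    rewrite /B -sum_lin_r /A !mulr_sumr -sumrB -big_split /=.
    by apply: eq_bigr => k _; ring.
  have -> : t ^+ 2 * \sum_(k < n) r k = t * B.
    rewrite expr2 -mulrA; congr (_ * _); rewrite sum_r.
    have := sum_odd_r n; rewrite -/B natrM /t => ?; lra.
  by rewrite -/t; lra.
have A0 : 0 < A by apply: lt_le_trans AB; rewrite mulr_gt0 ?divr_gt0.
exists (A^-1 *: p ^+ 2); split.
- by move=> x; rewrite hornerZ horner_exp mulr_ge0 ?sqr_ge0// invr_ge0 ltW.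
- by rewrite gaussEZ pA mulVf ?gt_eqF.
- by rewrite -scalerAl gaussEZ expr2 -mulrA [p * 'X]mulrC pXp mulr0.
- rewrite -scalerAl gaussEZ -exprMn [p * 'X]mulrC XpB mulrC.
  apply/andP; split; first by rewrite divr_ge0 ?ltW.
  rewrite ler_pdivrMr//.
  rewrite -(ler_pM2l eps0) in AB.
  apply: le_trans AB; rewrite mulrA -[leLHS]mul1r ler_pM2r// mulrA ler_pdivlMr ?mul1r//.
  rewrite ler_pdivrMr// mulrC in em; apply: (le_trans em).
  by rewrite ler_pM2l// ler_nat; lia.
Qed.
End hermite.

(** * Rayleigh's principle *)

Section rayleigh.
Context (R : realType).

Definition qform p (A : 'M[R]_p) (u v : 'rV[R]_p) : R := (u *m A *m v^T) 0 0.

Lemma qformDl p (A : 'M[R]_p) u u' v : qform A (u + u') v = qform A u v + qform A u' v.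
Proof. by rewrite /qform !mulmxDl mxE. Qed.

Lemma qformDr p (A : 'M[R]_p) u v v' : qform A u (v + v') = qform A u v + qform A u v'.
Proof. by rewrite /qform linearD mulmxDr mxE. Qed.

Lemma qformZl p (A : 'M[R]_p) a u v : qform A (a *: u) v = a * qform A u v.
Proof. by rewrite /qform -!scalemxAl mxE. Qed.

Lemma qformZr p (A : 'M[R]_p) a u v : qform A u (a *: v) = a * qform A u v.
Proof. by rewrite /qform linearZ -scalemxAr mxE. Qed.

Lemma qform_sym p (A : 'M[R]_p) u v : A^T = A -> qform A u v = qform A v u.
Proof.
move=> sA; have E : (u *m A *m v^T) = (v *m A *m u^T)^T.
  by rewrite !trmx_mul trmxK sA mulmxA.
by rewrite /qform E mxE.
Qed.

Lemma qform1 p (v : 'rV[R]_p) : qform 1%:M v v = \sum_i v 0 i ^+ 2.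
Proof. by rewrite /qform mulmx1 mxE; apply: eq_bigr => i _; rewrite mxE expr2. Qed.

Lemma qformE p (A : 'M[R]_p) u v : qform A u v = \sum_i (\sum_k u 0 k * A k i) * v 0 i.
Proof. by rewrite /qform mxE; apply: eq_bigr => i _; rewrite !mxE. Qed.

Lemma continuous_qform p (A : 'M[R]_p) : continuous (fun v : 'rV[R]_p => qform A v v).
Proof.
have -> : (fun v : 'rV[R]_p => qform A v v) =
    (fun v => \sum_i (\sum_k v 0 k * A k i) * v 0 i).
  by apply/funext => v; rewrite qformE.
apply: continuous_big => [|i _]; first exact: add_continuous.
have cA : continuous (fun v : 'rV[R]_p => \sum_k v 0 k * A k i).
  apply: continuous_big => [|k _]; first exact: add_continuous.
  move=> u; apply: (@continuousM R 'rV[R]_p (fun v => v 0 k) (fun=> A k i) u).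
    exact: coord_continuous.
  exact: cst_continuous.
move=> v.
apply: (@continuousM R 'rV[R]_p (fun v => \sum_k v 0 k * A k i) (fun v => v 0 i) v).
  exact: cA.
exact: coord_continuous.
Qed.

(** Moving v by t u changes the form by a polynomial in t without constant term,
    which is nonnegative only if its linear term vanishes. *)
Lemma psd_kernel p (A : 'M[R]_p) v : A^T = A -> (forall u, 0 <= qform A u u) ->
  qform A v v = 0 -> v *m A = 0.
Proof.
move=> sA A0 vv.
have orth u : qform A v u = 0.
  have pos t : 0 <= 2 * t * qform A v u + t ^+ 2 * qform A u u.
    have := A0 (v + t *: u).
    rewrite !(qformDl, qformDr, qformZl, qformZr) vv (qform_sym u v sA).
    set e := (X in 0 <= X -> _); rewrite (_ : e = 2 * t * qform A v u + t ^+ 2 * qform A u u)//.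
    by rewrite /e; ring.
  have := A0 u; set a := qform A v u in pos *; set b := qform A u u in pos *.
  (* the minimum of the polynomial is at - a / b; b + 1 avoids a null denominator *)
  move=> b0; have := pos (- a / (b + 1)).
  have b1 : b + 1 != 0 by rewrite gt_eqF// ltr_wpDl.
  have -> : 2 * (- a / (b + 1)) * a + (- a / (b + 1)) ^+ 2 * b =
      - (a ^+ 2 * ((b + 2) / (b + 1) ^+ 2)) by field.
  rewrite oppr_ge0 pmulr_lle0 ?divr_gt0 ?exprn_gt0 ?ltr_wpDl// => a2.
  by apply/eqP; rewrite -sqrf_eq0 eq_le a2 sqr_ge0.
apply/rowP => i; have := orth (delta_mx 0 i).
by rewrite /qform trmx_delta -colE !mxE.
Qed.

(** A minimiser of the form on the unit sphere is a null vector of the nonnegative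
    form of A - a. *)
Lemma exists_min_eigenvalue p (A : 'M[R]_p.+1) : A^T = A ->
  exists2 a, eigenvalue A a & forall v : 'rV[R]_p.+1, a * \sum_i v 0 i ^+ 2 <= qform A v v.
Proof.
move=> sA; pose N (v : 'rV[R]_p.+1) := \sum_i v 0 i ^+ 2.
have N1 v : N v = qform 1%:M v v by rewrite qform1.
pose S := [set v | N v = 1].
have S0 : S !=set0.
  exists (delta_mx 0 0); rewrite /S/= /N (bigD1 0)//= mxE !eqxx expr1n big1 ?addr0// => i i0.
  by rewrite mxE (negbTE i0) andbF expr0n.
have cS : compact S.
  apply: bounded_closed_compact.
    exists 1; split; first exact: num_real.
    move=> M M1 v /= Sv; rewrite -[leLHS]/(mx_norm v) mx_normrE.
    apply: bigmax_le => [|[i j] _ /=]; first exact/ltW/(lt_trans _ M1).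
    apply: le_trans (ltW M1); rewrite -(expr_le1 (n := 2))// -normrX ger0_norm ?sqr_ge0//.
    rewrite -Sv /N ord1 (bigD1 j)//= lerDl sumr_ge0// => k _; exact: sqr_ge0.
  rewrite (_ : S = (fun v => qform 1%:M v v) @^-1` [set 1]).
    apply: closed_comp => [v _|]; first exact: continuous_qform.
    exact: closed_eq.
  by apply/seteqP; split => v /=; rewrite /S/= N1.
have [v0 Sv0 minv0] := EVT_min_rV S0 cS
  (continuous_subspaceT (@continuous_qform _ A)).
have {}Sv0 : N v0 = 1 by move: Sv0; rewrite inE.
pose a := qform A v0 v0.
have le_a v : a * N v <= qform A v v.
  (* homogeneity reduces to the unit sphere *)
  have [Nv0|Nv0] := eqVneq (N v) 0.
    have -> : v = 0.
      apply/rowP => i; rewrite mxE; apply/eqP; rewrite -sqrf_eq0; apply/eqP.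
      move/eqP : Nv0; rewrite psumr_eq0 => [|k _]; last exact: sqr_ge0.
      by move/allP/(_ i (mem_index_enum i))/eqP.
    by rewrite N1 /qform !mul0mx mxE mulr0.
  have Nvp : 0 < N v by rewrite lt_def Nv0 sumr_ge0// => k _; exact: sqr_ge0.
  pose s := (Num.sqrt (N v))^-1.
  have s2 : s ^+ 2 = (N v)^-1 by rewrite exprVn sqr_sqrtr// ltW.
  have : a <= qform A (s *: v) (s *: v).
    apply: minv0; rewrite inE /S/= N1 qformZl qformZr -N1 mulrA -expr2 s2.
    by rewrite mulVf.
  by rewrite qformZl qformZr mulrA -expr2 s2 mulrC ler_pdivlMr.
exists a => //; apply/eigenvalueP; exists v0; last first.
  apply: contra_eq_neq Sv0 => ->; rewrite /N big1 => [|i _]; last by rewrite mxE expr0n.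
  by rewrite eq_sym oner_neq0.
have BE v : qform (A - a%:M) v v = qform A v v - a * N v.
  rewrite /qform mulmxBr mulmxBl mxE [in X in _ + X]mxE; congr (_ - _).
  by rewrite mul_mx_scalar -scalemxAl mxE N1 /qform mulmx1.
apply/eqP; rewrite -subr_eq0 -mul_mx_scalar -mulmxBr; apply/eqP/psd_kernel.
- by rewrite linearB/= tr_scalar_mx sA.
- by move=> u; rewrite BE subr_ge0.
- by rewrite BE Sv0 mulr1 subrr.
Qed.

Context (p n : nat) (X : 'M[R]_(p, n)).

Let qform_sample_cov v : qform (sample_cov X) v v =
  n%:R^-1 * \sum_j (\sum_i v 0 i * X i j) ^+ 2.
Proof.
have E : v *m (X *m X^T) *m v^T = (v *m X) *m (v *m X)^T by rewrite trmx_mul !mulmxA.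
rewrite /qform /sample_cov -scalemxAr -scalemxAl mxE E; congr (_ * _).
by rewrite mxE; apply: eq_bigr => j _; rewrite !mxE expr2.
Qed.

Let qform_sample_cov_ge0 v : 0 <= qform (sample_cov X) v v.
Proof.
by rewrite qform_sample_cov mulr_ge0// sumr_ge0// => j _; exact: sqr_ge0.
Qed.

Let eigenvalue_sample_cov_ge0 a : eigenvalue (sample_cov X) a -> 0 <= a.
Proof.
move=> /eigenvalueP[v vA v0]; have := qform_sample_cov_ge0 v.
rewrite /qform vA -scalemxAl mxE -[X in _ * X]/((v *m v^T) 0 0).
have -> : (v *m v^T) 0 0 = \sum_i v 0 i ^+ 2 by rewrite -qform1 /qform mulmx1.
rewrite pmulr_lge0// lt_def sumr_ge0 ?andbT => [|i _]; last exact: sqr_ge0.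
apply: contra v0; rewrite psumr_eq0 => [/allP v0|i _]; last exact: sqr_ge0.
apply/eqP/rowP => i; rewrite mxE; apply/eqP; rewrite -sqrf_eq0.
exact: (v0 i (mem_index_enum i)).
Qed.

Lemma min_eigenvalue_ge0 : 0 <= min_eigenvalue (sample_cov X).
Proof.
rewrite /min_eigenvalue; set E := [set a | _].
have [->|E0] := eqVneq E set0; first by rewrite inf0.
apply: lb_le_inf; first exact/set0P.
by move=> a /=; exact: eigenvalue_sample_cov_ge0.
Qed.



Lemma min_eigenvalue_le (v : 'I_p -> R) :
  min_eigenvalue (sample_cov X) * (\sum_i v i ^+ 2) <=
    n%:R^-1 * \sum_j (\sum_i v i * X i j) ^+ 2.
Proof.
pose u : 'rV[R]_p := \row_i v i.
have -> : \sum_i v i ^+ 2 = \sum_i u 0 i ^+ 2 by apply: eq_bigr => i _; rewrite mxE.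
have -> : n%:R^-1 * \sum_j (\sum_i v i * X i j) ^+ 2 = qform (sample_cov X) u u.
  rewrite qform_sample_cov; congr (_ * _); apply: eq_bigr => j _; congr (_ ^+ 2).
  by apply: eq_bigr => i _; rewrite mxE.
have sA : (sample_cov X)^T = sample_cov X.
  by rewrite /sample_cov linearZ/= trmx_mul trmxK.
move: (sample_cov X) qform_sample_cov_ge0 eigenvalue_sample_cov_ge0 sA => A A0 Aeig sA.
case: p u A A0 Aeig sA => [|p'] u A A0 Aeig sA.
  by rewrite big_ord0 mulr0.
have [a eiga le_a] := exists_min_eigenvalue sA.
apply: le_trans (le_a u); rewrite ler_wpM2r//.
  by rewrite sumr_ge0// => i _; exact: sqr_ge0.
by apply: ge_inf => //; exists 0 => b /=; exact: Aeig.
Qed.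

End rayleigh.

(** * Trigonometric waves on blocks *)

Section trigonometric_blocks.
Context (R : realType).

Lemma cosM (x y : R) : cos x * cos y = (cos (x - y) + cos (x + y)) / 2.
Proof. by rewrite cosB cosD; field. Qed.

(** Multiplied by sin (a / 2), with a the step of the phase, the sum telescopes; its
    two ends differ by l full turns. *)
Lemma sum_cos_period (b l : nat) (f : R) : (0 < l < b)%N ->
  \sum_(r < b) cos (f + pi *+ 2 * l%:R / b%:R * r%:R) = 0.
Proof.
move=> /andP[l0 lb]; have b0 : 0 < b%:R :> R by rewrite ltr0n (leq_trans _ lb).
set a := pi *+ 2 * l%:R / b%:R; pose s := sin (a / 2).
have a2 : a / 2 = pi * (l%:R / b%:R) by rewrite /a -mulr_natr; field; rewrite gt_eqF.
have s0 : s != 0.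
  rewrite gt_eqF// /s; apply: sin_gt0_pi; rewrite a2; apply/andP; split.
    by rewrite mulr_gt0 ?pi_gt0// divr_gt0// ltr0n.
  by rewrite gtr_pMr ?pi_gt0// ltr_pdivrMr// mul1r ltr_nat.
apply: (mulfI s0); rewrite mulr0 mulr_sumr.
have telE (r : nat) : s * cos (f + a * r%:R) =
    (sin (f + a * r.+1%:R - a / 2) - sin (f + a * r%:R - a / 2)) / 2.
  have -> : f + a * r.+1%:R - a / 2 = f + a * r%:R + a / 2 by rewrite -natr1; field.
  by rewrite sinD sinB /s; field.
under eq_bigr do rewrite telE.
rewrite -mulr_suml -(big_mkord xpredT (fun r =>
  sin (f + a * r.+1%:R - a / 2) - sin (f + a * r%:R - a / 2))).
rewrite telescope_sumr// mulr0 addr0.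
have -> : f + a * b%:R - a / 2 = f - a / 2 + pi *+ 2 *+ l.
  by rewrite /a -[_ *+ l]mulr_natr; field; rewrite gt_eqF.
by rewrite (periodicn (@sinD2pi R)) subrr mul0r.
Qed.

Lemma block_sum (b N B : nat) (F : nat -> R) : (0 < b)%N -> (B * b + b <= N)%N ->
  \sum_(s < N) (if (s %/ b == B)%N then F s else 0) = \sum_(r < b) F (r + B * b)%N.
Proof.
move=> b0 BN; rewrite -big_mkcond /=.
transitivity (\sum_(B * b <= s < B * b + b) F s).
  rewrite (big_nat_widen _ _ N)// (big_nat_widenl _ 0)// big_mkord.
  apply: eq_bigl => s /=; rewrite eqn_leq leq_divRL// -[(s %/ b <= B)%N]ltnS ltn_divLR//.
  by rewrite mulSn [(b + _)%N]addnC.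
by rewrite -{1}[(B * b)%N]add0n big_addn addKn big_mkord.
Qed.

Variables (N b J : nat).
Hypotheses (b0 : (0 < b)%N) (Jb : (2 * J < b)%N).

Definition freq (j : nat) : R := pi *+ 2 * j.+1%:R / b%:R.

Definition phase (c : bool) : R := if c then pi / 2 else 0.

(** The cosine (c = false) and the sine (c = true) of frequency j, cut to the block B
    and normalised. The sine is written as a cosine with another phase, so that one
    product formula covers all pairs. *)
Definition block_wave (k : 'I_J * ('I_(N %/ b) * bool)) (s : 'I_N) : R :=
  let: (j, (B, c)) := k in
  if (s %/ b == B)%N then Num.sqrt (2 / b%:R) * cos (freq j * s%:R - phase c) else 0.

Let bR : 0 < b%:R :> R. Proof. by rewrite ltr0n. Qed.

Let sum_cos_diff (j k : nat) f : (j < J)%N -> (k < J)%N ->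
  \sum_(r < b) cos (f + (freq j - freq k) * r%:R) = if j == k then b%:R * cos f else 0.
Proof.
move=> jJ kJ; have [<-|jk] := eqVneq j k.
  under eq_bigr do rewrite subrr mul0r addr0.
  by rewrite sumr_const card_ord mulr_natl.
wlog lt_kj : j k f jJ kJ jk / (k < j)%N => [H|].
  have [kj|kj] := ltnP k j; first exact: H.
  have lt_jk : (j < k)%N by rewrite ltn_neqAle jk.
  rewrite -[RHS](H k j (- f) kJ jJ _ lt_jk) 1?eq_sym//; apply: eq_bigr => r _.
  by rewrite -cosN; congr cos; ring.
under eq_bigr => r _.
  rewrite (_ : freq j - freq k = pi *+ 2 * (j - k)%:R / b%:R); last first.
    by rewrite natrB 1?ltnW// /freq -!natr1; field; rewrite gt_eqF.
  over.
by apply: sum_cos_period; lia.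
Qed.

Let sum_cos_add (j k : nat) f : (j < J)%N -> (k < J)%N ->
  \sum_(r < b) cos (f + (freq j + freq k) * r%:R) = 0.
Proof.
move=> jJ kJ; rewrite -[RHS](@sum_cos_period b (j + k).+2 f); last by lia.
apply: eq_bigr => r _; congr (cos (_ + _ * _)).
by rewrite /freq -!natr1 natrD; field; rewrite gt_eqF.
Qed.

Let sum_wave (j k B : nat) (f g : R) : (j < J)%N -> (k < J)%N ->
  \sum_(r < b) cos (freq j * (r + B * b)%:R - f) * cos (freq k * (r + B * b)%:R - g) =
  if j == k then b%:R / 2 * cos (g - f) else 0.
Proof.
move=> jJ kJ; under eq_bigr => r _.
  rewrite cosM.
  rewrite (_ : freq j * (r + B * b)%:R - f - (freq k * (r + B * b)%:R - g) =
    g - f + (freq j - freq k) * (B * b)%:R + (freq j - freq k) * r%:R); last first.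
    by rewrite natrD; ring.
  rewrite (_ : freq j * (r + B * b)%:R - f + (freq k * (r + B * b)%:R - g) =
    - (g + f) + (freq j + freq k) * (B * b)%:R + (freq j + freq k) * r%:R); last first.
    by rewrite natrD; ring.
  over.
rewrite -mulr_suml big_split /= sum_cos_diff// sum_cos_add// addr0.
have [<-|_] := eqVneq j k; last by rewrite mul0r.
by rewrite subrr mul0r addr0; ring.
Qed.

Let block_le (B : 'I_(N %/ b)) : (B * b + b <= N)%N.
Proof.
by rewrite addnC -mulSn (leq_trans _ (leq_trunc_div N b))// leq_mul2r ltn_ord orbT.
Qed.

Let cos_phase c c' : cos (phase c' - phase c) = (c == c')%:R.
Proof.
by case: c c' => -[]; rewrite /phase ?subrr ?subr0 ?sub0r ?cosN ?cos0 ?cos_pihalf.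
Qed.

Let sqrt2b : Num.sqrt (2 / b%:R) ^+ 2 = 2 / b%:R :> R.
Proof. by rewrite sqr_sqrtr// divr_ge0// ltW. Qed.

Lemma block_wave_orthonormal : orthonormal_family block_wave.
Proof.
move=> [j [B c]] [j' [B' c']]; rewrite /dot /block_wave !xpair_eqE.
have [<-|BB] := eqVneq B B'; last first.
  rewrite andbF big1// => s _; case: eqP => [sB|_]; last by rewrite mul0r.
  case: eqP => [sB'|_]; last by rewrite mulr0.
  by case/eqP : BB; apply: val_inj; rewrite /= -sB -sB'.
rewrite andTb; transitivity (\sum_(s < N) if (s %/ b == B)%N then
    2 / b%:R * (cos (freq j * s%:R - phase c) * cos (freq j' * s%:R - phase c')) else 0).
  by apply: eq_bigr => s _; case: ifP; rewrite ?mul0r// -[in RHS]sqrt2b => _; ring.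
rewrite (block_sum (fun s => 2 / b%:R * (cos (freq j * s%:R - phase c) *
  cos (freq j' * s%:R - phase c'))) b0 (block_le B)).
rewrite -mulr_sumr sum_wave// cos_phase (inj_eq val_inj).
have [_|_] := eqVneq j j'; last by rewrite mulr0.
by case: (c == c') => /=; field; rewrite gt_eqF.
Qed.

(** Along a whole block, a sinusoid with phase f is a combination of the two waves
    with coefficients cos f and sin f. *)
Lemma dot_block_wave (j : 'I_J) (B : 'I_(N %/ b)) (a : 'I_N -> R) (f : R) :
  (forall s : 'I_N, (s %/ b)%N = B -> a s = cos (freq j * s%:R - f)) ->
  dot a (block_wave (j, (B, true))) ^+ 2 + dot a (block_wave (j, (B, false))) ^+ 2 =
  b%:R / 2.
Proof.
move=> aB; have dE c : dot a (block_wave (j, (B, c))) =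
    Num.sqrt (2 / b%:R) * (b%:R / 2) * cos (phase c - f).
  rewrite /dot /block_wave; transitivity (\sum_(s < N) if (s %/ b == B)%N then
    Num.sqrt (2 / b%:R) * (cos (freq j * s%:R - f) * cos (freq j * s%:R - phase c)) else 0).
    by apply: eq_bigr => s _; case: eqP => [/aB ->|_]; rewrite ?mulr0//; ring.
  rewrite (block_sum (fun s => Num.sqrt (2 / b%:R) * (cos (freq j * s%:R - f) *
    cos (freq j * s%:R - phase c))) b0 (block_le B)).
  by rewrite -mulr_sumr sum_wave// eqxx mulrA.
rewrite !dE !exprMn sqrt2b -mulrDr.
have -> : cos (phase true - f) ^+ 2 + cos (phase false - f) ^+ 2 = 1.
  rewrite /phase sub0r cosN cosB cos_pihalf sin_pihalf mul0r add0r mul1r addrC.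
  exact: cos2Dsin2.
by field; rewrite gt_eqF.
Qed.

End trigonometric_blocks.

(** * Convolution windows on a cycle *)

Section cyclic_windows.
Context (R : realType) (N : nat).

(** The reflection s |-> t - s of the cycle Z/N: the lag with which the coordinate s
    enters the t-th value of a convolution. *)
Definition reflect_ord (t s : 'I_N) : 'I_N :=
  Ordinal (ltn_pmod (t + N - s) (leq_ltn_trans (leq0n t) (ltn_ord t))).
Arguments reflect_ord : simpl never.

Lemma reflect_ord_le (t s : 'I_N) : (s <= t)%N -> reflect_ord t s = (t - s)%N :> nat.
Proof.
move=> st; rewrite /reflect_ord /= -addnBAC// modnDr modn_small//.
by rewrite (leq_ltn_trans (leq_subr _ _))// ltn_ord.
Qed.

Lemma reflect_ord_gt (t s : 'I_N) : (t < s)%N -> reflect_ord t s = (t + N - s)%N :> nat.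
Proof. by move=> ts; rewrite /reflect_ord /= modn_small//; have := ltn_ord s; lia. Qed.

Lemma reflect_ordK (t : 'I_N) : involutive (reflect_ord t).
Proof.
move=> s; apply: ord_inj; have tN := ltn_ord t; have sN := ltn_ord s.
have [st|ts] := leqP s t.
  have E := reflect_ord_le st.
  have E' : (reflect_ord t s <= t)%N by rewrite E leq_subr.
  by rewrite (reflect_ord_le E') E subKn.
have E := reflect_ord_gt ts.
have E' : (t < reflect_ord t s)%N by rewrite E; lia.
by rewrite (reflect_ord_gt E') E; lia.
Qed.

(** The coefficients of the t-th value of the convolution with f cut to [0, p). *)
Definition window p (f : nat -> R) (t s : 'I_N) : R :=
  if (reflect_ord t s < p)%N then f (reflect_ord t s) else 0.

Lemma window_sum p (G : nat -> 'I_N -> R) (t : 'I_N) (pN : (p <= N)%N) :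
  \sum_s (if (reflect_ord t s < p)%N then G (reflect_ord t s) s else 0) =
  \sum_(i < p) G i (reflect_ord t (widen_ord pN i)).
Proof.
rewrite (reindex_inj (can_inj (reflect_ordK t))).
rewrite (eq_bigr (fun s : 'I_N => if (s < p)%N then G s (reflect_ord t s) else 0)); last first.
  by move=> s _; rewrite (reflect_ordK t s).
by rewrite -big_mkcond /= (big_ord_narrow pN).
Qed.

Lemma dot_window p (f : nat -> R) t : (p <= N)%N ->
  dot (window p f t) (window p f t) = \sum_(i < p) f i ^+ 2.
Proof.
move=> pN; rewrite -(window_sum (fun i _ => f i ^+ 2) t pN).
by apply: eq_bigr => s _; rewrite /window; case: ifP; rewrite ?mul0r ?expr2.
Qed.

Lemma lin_window d (T : measurableType d) (y : 'I_N -> T -> R) p (f : nat -> R) t w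
    (pN : (p <= N)%N) :
  lin y (window p f t) w = \sum_(i < p) f i * y (reflect_ord t (widen_ord pN i)) w.
Proof.
rewrite -(window_sum (fun i s => f i * y s w)); apply: eq_bigr => s _.
by rewrite /window; case: ifP; rewrite ?mul0r.
Qed.

Lemma leq_sum_interval (l h B : nat) : (h <= B)%N ->
  (h - l <= \sum_(i < B) (l <= i < h))%N.
Proof.
elim: B h => [|B IH] h; first by rewrite leqn0 => /eqP ->; rewrite big_ord0.
rewrite leq_eqVlt ltnS big_ord_recr /= => /predU1P[->|hB]; last first.
  exact: leq_trans (IH _ hB) (leq_addr _ _).
have E : (\sum_(i < B) (l <= i < B.+1) = \sum_(i < B) (l <= i < B))%N.
  by apply: eq_bigr => i _; have := ltn_ord i; lia.
by have := IH B (leqnn B); rewrite E ltnSn andbT; case: (leqP l B) => ? /=; lia.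
Qed.

Variables (p b J : nat).
Hypotheses (pN : (p <= N)%N) (b0 : (0 < b)%N) (Jb : (2 * J < b)%N).

(** On a full block inside the window the lag is m - s for a fixed m, so that the
    window is a sinusoid there. The places lost belong to blocks that are cut by an
    end of the window, by its passage from N - 1 to 0, or by the end of the cycle. *)
Lemma window_captured (j : 'I_J) (t : 'I_N) :
  p%:R - (4 * b)%:R <=
  \sum_k dot (window p (fun i => cos (freq R b j * i%:R)) t) (@block_wave R N b J (j, k)) ^+ 2 +
  \sum_k dot (window p (fun i => sin (freq R b j * i%:R)) t) (@block_wave R N b J (j, k)) ^+ 2.
Proof.
set ac := window _ _ _; set as_ := window _ _ _.
(* the full blocks in the part of the window below t have indices in [l1, h1), those
   in the part that wraps around have indices in [l2, h2) *)
pose l1 := ((t.+1 - p + b.-1) %/ b)%N; pose h1 := (t.+1 %/ b)%N.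
pose l2 := ((t + N + 1 - p + b.-1) %/ b)%N; pose h2 := (N %/ b)%N.
pose wave B c := @block_wave R N b J (j, (B, c)).
pose energy B : R :=
  (dot ac (wave B true) ^+ 2 + dot ac (wave B false) ^+ 2) +
  (dot as_ (wave B true) ^+ 2 + dot as_ (wave B false) ^+ 2).
have tN := ltn_ord t.
have cap (B : 'I_(N %/ b)) (m : nat) :
    (forall s : 'I_N, (s %/ b)%N = B -> (reflect_ord t s < p)%N /\ (reflect_ord t s + s)%N = m) ->
  energy B = b%:R.
  move=> Bm.
  have sE (s : 'I_N) : (s %/ b)%N = B -> (reflect_ord t s)%:R = m%:R - s%:R :> R.
    by move=> /Bm[_ <-]; rewrite natrD addrK.
  rewrite /energy (dot_block_wave b0 Jb (f := freq R b j * m%:R)).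
    rewrite (dot_block_wave b0 Jb (f := freq R b j * m%:R - pi / 2)); first by field.
    move=> s sB; rewrite /as_ /window (Bm s sB).1 sE//.
    rewrite -[LHS]cosBpihalf -[RHS]cosN; congr cos; ring.
  move=> s sB; rewrite /ac /window (Bm s sB).1 sE// -[RHS]cosN; congr cos; ring.
have dB (B s : nat) : (s %/ b)%N = B -> (B * b <= s < B * b + b)%N.
  move=> <-; rewrite leq_trunc_div /= [X in (X < _)%N](divn_eq s b) ltn_add2l.
  by rewrite ltn_pmod.
have capB (B : 'I_(N %/ b)) :
  b%:R * ((l1 <= B < h1) + (l2 <= B < h2))%:R <=
  energy B.
  have nn : 0 <= energy B.
    by rewrite /energy !addr_ge0 ?sqr_ge0.
  have [/andP[lB Bh]|_] := boolP (l1 <= B < h1)%N.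
    have {}Bh : (B * b + b <= t.+1)%N by rewrite addnC -mulSn -leq_divRL.
    have {}lB : (t.+1 - p <= B * b)%N.
      by move: lB; rewrite /l1 -ltnS ltn_divLR// mulSn; lia.
    have -> : (l2 <= B < h2)%N = false.
      apply/negbTE; rewrite negb_and -ltnNge; apply/orP; left.
      by rewrite /l2 leq_divRL// mulSn; lia.
    (* without wrapping, lag + s = t *)
    rewrite addn0 mulr1 (cap B t)// => s /dB /andP[s1 s2].
    have st : (s <= t)%N by lia.
    by rewrite (reflect_ord_le st); split; lia.
  have [/andP[lB _]|_] := boolP (l2 <= B < h2)%N; last by rewrite addn0 mulr0.
  have {}lB : (t + N + 1 - p <= B * b)%N.
    by move: lB; rewrite /l2 -ltnS ltn_divLR// mulSn; lia.
  (* after wrapping, lag + s = t + N *)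
  rewrite add0n mulr1 (cap B (t + N)%N)// => s /dB /andP[s1 s2].
  have st : (t < s)%N by lia.
  by rewrite (reflect_ord_gt st); have := ltn_ord s; split; lia.
have sumE (F : 'I_(N %/ b) * bool -> R) : \sum_k F k = \sum_B (F (B, true) + F (B, false)).
  rewrite (eq_bigr (fun k => F (k.1, k.2))) => [|[]//].
  rewrite -(pair_bigA _ (fun B c => F (B, c))) /=; apply: eq_bigr => B _.
  by rewrite big_bool.
rewrite !sumE -big_split /=; apply: le_trans (ler_sum _ (fun B _ => capB B)).
rewrite -mulr_sumr -natr_sum big_split /= lerBlDr -natrM -natrD ler_nat.
have h1N : (h1 <= N %/ b)%N by rewrite leq_div2r.
have := leq_sum_interval l1 h1N; have := leq_sum_interval l2 (leqnn h2).
rewrite -/h2; set S2 := (\sum_(_ < _) _)%N; set S1 := (\sum_(_ < _) _)%N => le2 le1.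
have : (b * (h2 - l2) + b * (h1 - l1) <= b * (S1 + S2))%N.
  by rewrite mulnDr [leqRHS]addnC leq_add// leq_mul2l ?le1 ?le2 orbT.
rewrite !mulnBr.
have e1 : (b * h1 + b > t.+1)%N.
  by rewrite {1}(divn_eq t.+1 b) mulnC ltn_add2l ltn_pmod.
have e2 : (b * h2 + b > N)%N.
  by rewrite {1}(divn_eq N b) mulnC ltn_add2l ltn_pmod.
have f1 : (b * l1 <= t.+1 - p + b.-1)%N by rewrite mulnC leq_trunc_div.
have f2 : (b * l2 <= t + N + 1 - p + b.-1)%N by rewrite mulnC leq_trunc_div.
move: (b * h1)%N (b * h2)%N (b * l1)%N (b * l2)%N (b * (S1 + S2))%N e1 e2 f1 f2; lia.
Qed.

End cyclic_windows.

(** * From weighted averages to moments *)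

Section elementary_bounds.
Context (R : realType).
Implicit Types x s : R.

Lemma exprn_tangent m x s : 0 <= x -> 0 <= s ->
  s ^+ m.+1 + m.+1%:R * s ^+ m * (x - s) <= x ^+ m.+1.
Proof.
move=> x0 s0; elim: m => [|m IH]; first by rewrite !expr1 expr0 mulr1 mul1r addrC subrK.
rewrite -subr_ge0; have := ler_wpM2l x0 IH; rewrite -subr_ge0 => H.
rewrite (_ : _ - _ = x * x ^+ m.+1 - x * (s ^+ m.+1 + m.+1%:R * s ^+ m * (x - s)) +
    m.+1%:R * s ^+ m * (x - s) ^+ 2); last first.
  by rewrite -[m.+2%:R]natr1 !exprS; ring.
by rewrite addr_ge0// mulr_ge0 ?sqr_ge0// mulr_ge0// exprn_ge0.
Qed.

(** Jensen's inequality, by comparison with the tangent at the average. *)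
Lemma exprn_average_le N m (a : 'I_N -> R) : (0 < N)%N -> (forall i, 0 <= a i) ->
  (N%:R^-1 * \sum_i a i) ^+ m.+1 <= N%:R^-1 * \sum_i a i ^+ m.+1.
Proof.
move=> N0 a0; have NR : 0 < N%:R :> R by rewrite ltr0n.
set s := N%:R^-1 * _; have s0 : 0 <= s by apply: mulr_ge0; [rewrite invr_ge0 ltW|apply: sumr_ge0].
rewrite ler_pdivlMl//.
have -> : N%:R * s ^+ m.+1 = \sum_i (s ^+ m.+1 + m.+1%:R * s ^+ m * (a i - s)).
  rewrite big_split /= -mulr_sumr sumrB !sumr_const card_ord.
  have -> : \sum_i a i = N%:R * s by rewrite /s mulVKf ?gt_eqF.
  by rewrite -[s *+ N]mulr_natl subrr mulr0 addr0 mulr_natl.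
by apply: ler_sum => i _; exact: exprn_tangent.
Qed.

(** Both cases split off a small multiple t of a crude bound Q; the remaining
    part is controlled by the ratio Nu / D when D is not far from 1, and by the
    deviation of D from 1 otherwise. *)
Lemma ratio_power_bound (l Q Nu D t : R) k : 0 <= l -> l <= Q -> l * D <= Nu ->
  0 <= Nu -> 0 < t -> (0 < k)%N ->
  l ^+ k <= Nu / t + 2 * (1 - D) ^+ 2 / t + t * (1 + Q ^+ (2 * k)).
Proof.
move=> l0 lQ lD Nu0 t0 k0; have Q0 : 0 <= Q by exact: le_trans lQ.
have ti0 : 0 < t^-1 by rewrite invr_gt0.
have D2 : 0 <= 2 * (1 - D) ^+ 2 / t by rewrite mulr_ge0 ?(ltW ti0)// mulr_ge0// sqr_ge0.
have Nt : 0 <= Nu / t by rewrite mulr_ge0 ?(ltW ti0).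
have lQk j : l ^+ j <= Q ^+ j by rewrite lerXn2r ?nnegrE.
have [D1|D1] := leP (1 / 2) D.
- have l2 : l <= 2 * Nu by nra.
  case: k k0 => // k _.
  have amgm : l ^+ k.+1 <= l / t / 2 + t * l ^+ (2 * k).+1 / 2.
    rewrite -subr_ge0 (_ : _ - _ = l / t / 2 * (1 - t * l ^+ k) ^+ 2).
      by rewrite mulr_ge0 ?sqr_ge0// !mulr_ge0// ltW.
    by rewrite [(2 * k)%N]mulnC !exprS exprM; field; rewrite gt_eqF.
  have e1 : l / t / 2 <= Nu / t by rewrite mulrAC ler_pM2r// ler_pdivrMr// mulrC.
  have e2 : l ^+ (2 * k).+1 <= 1 + Q ^+ (2 * k.+1).
    have [l1|/ltW l1] := leP l 1.
      by apply: (@le_trans _ _ 1); [exact: exprn_ile1|rewrite lerDl exprn_ge0].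
    apply: (@le_trans _ _ (Q ^+ (2 * k.+1))); last by rewrite lerDr.
    by apply: le_trans (lQk _); rewrite ler_weXn2l// mulnS.
  have e3 : t * l ^+ (2 * k).+1 / 2 <= t * (1 + Q ^+ (2 * k.+1)).
    rewrite ler_pdivrMr// -mulrA ler_pM2l//.
    have := exprn_ge0 (2 * k).+1 l0; lra.
  lra.
have amgm : Q ^+ k <= t^-1 / 2 + t * Q ^+ (2 * k) / 2.
  rewrite -subr_ge0 (_ : _ - _ = t^-1 / 2 * (1 - t * Q ^+ k) ^+ 2).
    by rewrite mulr_ge0 ?sqr_ge0// mulr_ge0// ltW.
  by rewrite [(2 * k)%N]mulnC exprM; field; rewrite gt_eqF.
have e1 : t^-1 / 2 <= 2 * (1 - D) ^+ 2 / t.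
  rewrite mulrC ler_pM2r//; nra.
have e3 : t * Q ^+ (2 * k) / 2 <= t * (1 + Q ^+ (2 * k)).
  rewrite ler_pdivrMr// -mulrA ler_pM2l//.
  have := exprn_ge0 (2 * k) Q0; lra.
have := lQk k; lra.
Qed.

End elementary_bounds.

(** The integral of a nonnegative function is a supremum over the simple functions
    below it, which makes it monotone among all functions, measurable or not. *)
Lemma ge0_le_integral_nomeas d (T : measurableType d) (R : realType)
    (mu : {measure set T -> \bar R}) (f g : T -> \bar R) :
  (forall x, 0 <= f x)%E -> (forall x, f x <= g x)%E ->
  (\int[mu]_x f x <= \int[mu]_x g x)%E.
Proof.
move=> f0 fg; rewrite !ge0_integralTE//; last by move=> x; exact: le_trans (fg x).
apply: le_ereal_sup => _ /= [h hf <-].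
by exists h => // x; exact: le_trans (hf x) (fg x).
Qed.

Section concentration.
Context d (T : measurableType d) (R : realType) (P : probability T R).
Variables (N p n b J : nat) (y : 'I_N -> T -> R) (lam : T -> R) (q : {poly R}).
Hypotheses (p0 : (0 < p)%N) (pN : (p <= N)%N) (Nn : (N <= 2 * n)%N).
Hypotheses (J0 : (0 < J)%N) (Jb : (2 * J < b)%N).
Hypothesis wy : wick P y.
Hypotheses (q0 : forall x, 0 <= q.[x]) (q1 : gaussE q = 1)
  (qX : gaussE (q * 'X) = 0) (qX2 : 0 <= gaussE (q * 'X^2) <= 1).
Hypothesis lam0 : forall w, 0 <= lam w.
Hypothesis lam_le : forall (f : nat -> R) w,
  lam w * (\sum_(i < p) f i ^+ 2) <=
  n%:R^-1 * \sum_t (lin y (window p f t) w) ^+ 2.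

Let eps := gaussE (q * 'X^2).
Let g := gaussE (q ^+ 2).

Let N0 : (0 < N)%N. Proof. exact: leq_trans pN. Qed.
Let n0 : (0 < n)%N. Proof. by have := leq_trans N0 Nn; case: n. Qed.
Let b0 : (0 < b)%N. Proof. exact: leq_ltn_trans Jb. Qed.
Let pR : 0 < p%:R :> R. Proof. by rewrite ltr0n. Qed.
Let nR : 0 < n%:R :> R. Proof. by rewrite ltr0n. Qed.
Let NR : 0 < N%:R :> R. Proof. by rewrite ltr0n. Qed.
Let JR : 0 < J%:R :> R. Proof. by rewrite ltr0n. Qed.

Let Nn2 : N%:R / n%:R <= 2 :> R.
Proof. by rewrite ler_pdivrMr// -natrM ler_nat. Qed.

Let fcos (j : 'I_J) i : R := cos (freq R b j * i%:R).
Let fsin (j : 'I_J) i : R := sin (freq R b j * i%:R).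

(* p times the Rayleigh quotient of the exponential of frequency j *)
Let energy (j : 'I_J) w : R := n%:R^-1 *
  \sum_t (lin y (window p (fcos j) t) w ^+ 2 + lin y (window p (fsin j) t) w ^+ 2).

Let W (j : 'I_J) : T -> R := weight y q (fun k => @block_wave R N b J (j, k)).

Let Num w : R := J%:R^-1 * \sum_j W j w * (energy j w / p%:R).
Let Den w : R := J%:R^-1 * \sum_j W j w.
Let Q0 w : R := n%:R^-1 * \sum_t y t w ^+ 2.

Let hy t : has_moments P (y t). Proof. by case: wy. Qed.
Let hlin a : has_moments P (lin y a). Proof. exact: has_moments_lin. Qed.
Let hW j : has_moments P (W j). Proof. exact: has_moments_weight. Qed.
Let henergy j : has_moments P (energy j).
Proof.
apply: has_momentsZ; apply: has_moments_sum => t _.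
by apply: has_momentsD; apply: has_momentsX.
Qed.
Let hNum : has_moments P Num.
Proof.
apply: has_momentsZ; apply: has_moments_sum => j _; apply: has_momentsM => //.
by apply: has_momentsM => //; exact: has_moments_cst.
Qed.
Let hDen : has_moments P Den.
Proof. by apply: has_momentsZ; exact: has_moments_sum. Qed.
Let hQ0 : has_moments P Q0.
Proof. by apply: has_momentsZ; apply: has_moments_sum => t _; exact: has_momentsX. Qed.

Let W0 j w : 0 <= W j w. Proof. by apply: prodr_ge0 => k _. Qed.

Let energy_ge0 j w : 0 <= energy j w.
Proof.
by rewrite mulr_ge0 ?invr_ge0// sumr_ge0// => t _; rewrite addr_ge0 ?sqr_ge0.
Qed.

Let lam_energy j w : lam w <= energy j w / p%:R.
Proof.
rewrite ler_pdivlMr//; have := lerD (lam_le (fcos j) w) (lam_le (fsin j) w).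
rewrite -!mulrDr -!big_split /= (eq_bigr (fun=> 1)) => [|i _]; last exact: cos2Dsin2.
by rewrite sumr_const card_ord.
Qed.

Let lam_ratio w : lam w * Den w <= Num w.
Proof.
rewrite /Den /Num mulrCA ler_pM2l ?invr_gt0// mulr_sumr; apply: ler_sum => j _.
by rewrite mulrC ler_wpM2l.
Qed.

Let lam_Q0 w : lam w <= Q0 w.
Proof.
(* the first basis vector *)
have := lam_le (fun i => (i == 0%N)%:R) w.
have -> : \sum_(i < p) ((i == 0 :> nat)%:R : R) ^+ 2 = 1.
  rewrite (bigD1 (Ordinal p0))//= expr1n big1 ?addr0// => i.
  by rewrite -val_eqE /= => /negbTE ->; rewrite expr0n.
rewrite mulr1 => /le_trans; apply; rewrite ler_pM2l ?invr_gt0//.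
apply: ler_sum => t _; rewrite (lin_window _ _ _ _ pN).
rewrite (bigD1 (Ordinal p0))//= mul1r big1 ?addr0 => [|i]; last first.
  by rewrite -val_eqE /= => /negbTE ->; rewrite mul0r.
rewrite (_ : reflect_ord t _ = t)//; apply: ord_inj.
by rewrite reflect_ord_le ?subn0.
Qed.

Let Num_ge0 w : 0 <= Num w.
Proof.
apply: mulr_ge0; first by rewrite invr_ge0.
apply: sumr_ge0 => j _; apply: mulr_ge0 => //; exact: mulr_ge0.
Qed.

Let Ex_energy j : Ex P (fun w => W j w * energy j w) <= 2 * (eps * p%:R + (4 * b)%:R).
Proof.
have ou : orthonormal_family (fun k => @block_wave R N b J (j, k)).
  by move=> k k'; rewrite block_wave_orthonormal// xpair_eqE eqxx.
have E f t : Ex P (fun w => W j w * lin y (window p f t) w ^+ 2) =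
    \sum_(i < p) f i ^+ 2 - (1 - eps) * \sum_k dot (window p f t) (@block_wave R N b J (j, k)) ^+ 2.
  by rewrite (Ex_weight_sqr wy q1 qX ou) dot_window.
have -> : Ex P (fun w => W j w * energy j w) = n%:R^-1 * \sum_t
    (Ex P (fun w => W j w * lin y (window p (fcos j) t) w ^+ 2) +
     Ex P (fun w => W j w * lin y (window p (fsin j) t) w ^+ 2)).
  have hf f t : has_moments P (fun w => W j w * lin y (window p f t) w ^+ 2).
    by apply: has_momentsM => //; exact: has_momentsX.
  transitivity (Ex P (fun w => n%:R^-1 * \sum_t (W j w * lin y (window p (fcos j) t) w ^+ 2
      + W j w * lin y (window p (fsin j) t) w ^+ 2))).
    apply: eq_Ex => w; rewrite /energy mulrCA mulr_sumr; congr (_ * _).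
    by apply: eq_bigr => t _; rewrite mulrDr.
  rewrite ExZ; last by apply: has_moments_sum => t _; exact: has_momentsD.
  rewrite Ex_sum => [|t _]; last exact: has_momentsD.
  by congr (_ * _); apply: eq_bigr => t _; rewrite ExD.
apply: (@le_trans _ _ (n%:R^-1 * (N%:R * (eps * p%:R + (4 * b)%:R)))).
  rewrite ler_pM2l ?invr_gt0//.
  have -> : N%:R * (eps * p%:R + (4 * b)%:R) = \sum_(t < N) (eps * p%:R + (4 * b)%:R).
    by rewrite sumr_const card_ord mulr_natl.
  apply: ler_sum => t _; rewrite !E addrACA -big_split /=.
  rewrite (eq_bigr (fun=> 1)) => [|i _]; last exact: cos2Dsin2.
  rewrite sumr_const card_ord -opprD -mulrDr.
  have := window_captured R pN b0 Jb j t; move: qX2 => /andP[]; rewrite -/eps.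
  rewrite -/(fcos j) -/(fsin j); set S := (X in _ <= X).
  have : 0 <= (4 * b)%:R :> R by [].
  move: (p%:R : R) ((4 * b)%:R : R) => pp bb; rewrite /S; nra.
rewrite mulrA [_^-1 * _]mulrC ler_wpM2r// addr_ge0// mulr_ge0//.
by case/andP: qX2.
Qed.

Let Ex_Num : Ex P Num <= 2 * (eps + (4 * b)%:R / p%:R).
Proof.
rewrite /Num ExZ; last first.
  apply: has_moments_sum => j _; apply: has_momentsM => //.
  by apply: has_momentsM => //; exact: has_moments_cst.
rewrite Ex_sum => [|j _]; last first.
  by apply: has_momentsM => //; apply: has_momentsM => //; exact: has_moments_cst.
rewrite ler_pdivrMl//.
have -> : J%:R * (2 * (eps + (4 * b)%:R / p%:R)) = \sum_(j < J) (2 * (eps + (4 * b)%:R / p%:R)).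
  by rewrite sumr_const card_ord mulr_natl.
apply: ler_sum => j _.
have -> : Ex P (fun w => W j w * (energy j w / p%:R)) =
    p%:R^-1 * Ex P (fun w => W j w * energy j w).
  rewrite -ExZ; last exact: has_momentsM.
  by apply: eq_Ex => w; ring.
rewrite ler_pdivrMl//; apply: le_trans (Ex_energy j) _.
by rewrite le_eqVlt; apply/orP; left; apply/eqP; field; rewrite gt_eqF.
Qed.

Let Ex_Den : Ex P (fun w => (1 - Den w) ^+ 2) <= g ^+ (N %/ b * 2) / J%:R.
Proof.
have := weight_average_var wy q1 (@block_wave_orthonormal R N b J b0 Jb).
by rewrite !card_ord card_prod card_ord card_bool => /(_ J0).
Qed.

Let Ex_Q0 m : Ex P (fun w => Q0 w ^+ m.+1) <= 2 ^+ m.+1 * gauss_mom R (2 * m.+1).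
Proof.
have hX t : has_moments P (fun w => y t w ^+ 2 ^+ m.+1).
  by apply: has_momentsX; exact: has_momentsX.
apply: (@le_trans _ _ (Ex P (fun w => 2 ^+ m.+1 *
    (N%:R^-1 * \sum_t y t w ^+ 2 ^+ m.+1)))).
  apply: Ex_le; first exact: has_momentsX.
    by do 2 apply: has_momentsZ; exact: has_moments_sum.
  move=> w; apply: (@le_trans _ _ (2 ^+ m.+1 * (N%:R^-1 * \sum_t y t w ^+ 2) ^+ m.+1)).
    rewrite -exprMn lerXn2r ?nnegrE//.
    - by rewrite mulr_ge0 ?invr_ge0// sumr_ge0// => t _; exact: sqr_ge0.
    - by rewrite !mulr_ge0 ?invr_ge0// sumr_ge0// => t _; exact: sqr_ge0.
    rewrite /Q0 mulrA ler_wpM2r ?sumr_ge0// => [t _|]; first exact: sqr_ge0.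
    by rewrite ler_pdivlMr// mulrC.
  by rewrite ler_wpM2l ?exprn_ge0// exprn_average_le// => t; exact: sqr_ge0.
rewrite ExZ; last by apply: has_momentsZ; exact: has_moments_sum.
rewrite ExZ; last exact: has_moments_sum.
rewrite Ex_sum// (eq_bigr (fun=> gauss_mom R (2 * m.+1))) => [|t _].
  by rewrite sumr_const card_ord -[X in _ * (_ * X)]mulr_natl mulKf// gt_eqF.
have nil : {in [::], forall a : 'I_N, a \notin [:: t]} by [].
have := Ex_prod_poly wy (s := [:: t]) (fun=> 'X^(2 * m.+1)) isT nil.
rewrite [X in _ * X](eq_Ex _ (g := fun=> 1)) ?Ex_cst => [|w]; last by rewrite big_nil.
rewrite big_seq1 gaussEXn mulr1 => <-; apply: eq_Ex => w.
by rewrite big_seq1 big_nil mulr1 hornerXn exprM.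
Qed.

(** The three terms come from the mean of Num, from the variance of Den, and from the
    crude bound Q0; t is chosen first, then q, then b / p, and p comes last. *)
Lemma lam_power_bound k t : (0 < k)%N -> 0 < t -> exists G,
  [/\ has_moments P G, forall w, lam w ^+ k <= G w &
    Ex P G <= 2 * (gaussE (q * 'X^2) + (4 * b)%:R / p%:R) / t +
      2 * (gaussE (q ^+ 2) ^+ (N %/ b * 2) / J%:R) / t +
      t * (1 + 2 ^+ (2 * k) * gauss_mom R (2 * (2 * k)))].
Proof.
move=> k0 t0.
exists (fun w => Num w / t + 2 * (1 - Den w) ^+ 2 / t + t * (1 + Q0 w ^+ (2 * k))).
have hc c : has_moments P (fun=> c : R) by exact: has_moments_cst.
have hD : has_moments P (fun w => (1 - Den w) ^+ 2).
  by apply: has_momentsX; exact: has_momentsB.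
have hQ : has_moments P (fun w => Q0 w ^+ (2 * k)) by exact: has_momentsX.
have h1 : has_moments P (fun w => t^-1 * Num w) by exact: has_momentsZ.
have h2 : has_moments P (fun w => 2 / t * (1 - Den w) ^+ 2) by exact: has_momentsZ.
have h3 : has_moments P (fun w => t * (1 + Q0 w ^+ (2 * k))).
  by apply: has_momentsZ; exact: has_momentsD.
have E : (fun w => Num w / t + 2 * (1 - Den w) ^+ 2 / t + t * (1 + Q0 w ^+ (2 * k))) =
    (fun w => t^-1 * Num w + 2 / t * (1 - Den w) ^+ 2 + t * (1 + Q0 w ^+ (2 * k))).
  by apply/funext => w; rewrite mulrC mulrAC.
rewrite E; split; first by apply: has_momentsD => //; exact: has_momentsD.
  by move=> w; exact: ratio_power_bound.
have h4 : has_moments P (fun w => 1 + Q0 w ^+ (2 * k)) by exact: has_momentsD.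
rewrite (ExD (has_momentsD h1 h2) h3) (ExD h1 h2) (ExZ _ hNum) (ExZ _ hD) (ExZ _ h4).
rewrite (ExD (hc 1) hQ) Ex_cst; apply: lerD; last first.
  rewrite ler_pM2l// lerD2l; case: k k0 {hQ h3 h4 E} => // k _.
  by rewrite mulnS add2n; exact: Ex_Q0.
by apply: lerD; [rewrite mulrC ler_pM2r ?invr_gt0|rewrite mulrAC ler_pM2r ?invr_gt0// ler_pM2l].
Qed.

End concentration.

(** The first power dominates for l <= 1, the K-th one for l >= 1. *)
Lemma powR_le_expr (R : realType) (l kappa : R) (K : nat) : 0 <= l -> 1 <= kappa ->
  kappa <= K%:R -> l `^ kappa <= l ^+ 1 + l ^+ K.
Proof.
move=> l0 k1 kK; rewrite expr1; have [->|ln0] := eqVneq l 0.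
  rewrite powR0 ?gt_eqF ?(lt_le_trans _ k1)// add0r exprn_ge0//.
have lp : 0 < l by rewrite lt_def ln0.
have [l1|/ltW l1] := leP l 1.
  by rewrite (le_trans (ge1r_powR _ k1)) ?lp// lerDl exprn_ge0.
by rewrite (le_trans (ler_powR l1 kK))// powR_mulrn// lerDr.
Qed.

(** With b = p / m, the number N / b of blocks stays bounded, while the number J of
    usable frequencies grows with p. *)
Lemma block_count (m J0 p C n N : nat) : (0 < m)%N -> (0 < J0)%N ->
  (m * (2 * J0 + 1) <= p)%N -> (N <= 2 * n)%N -> (n <= C * p)%N ->
  exists b J, [/\ (J0 <= J)%N, (2 * J < b)%N, (m * b <= p)%N & (N %/ b <= 4 * C * m)%N].
Proof.
move=> m0 J00 pbig Nn npC; exists (p %/ m)%N, ((p %/ m).-1 %/ 2)%N.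
have mb : (m * (p %/ m) <= p)%N by rewrite mulnC leq_trunc_div.
have pm := ltn_ceil p m0.
have bJ0 : (2 * J0 + 1 <= p %/ m)%N by rewrite leq_divRL// mulnC.
move: (p %/ m)%N mb pm bJ0 => b mb pm bJ0; split => //.
- by rewrite leq_divRL//; lia.
- by have := leq_trunc_div b.-1 2; lia.
have b0 : (0 < b)%N by lia.
rewrite -(mulnK (4 * C * m) b0) leq_div2r// (leq_trans Nn)//.
have pm2 : (p <= 2 * (m * b))%N.
  apply: leq_trans (ltnW pm) _; rewrite mulSn mul2n -addnn [(b * m)%N]mulnC leq_add2r.
  by rewrite leq_pmulr.
apply: leq_trans (leq_mul (leqnn 2) npC) _.
apply: leq_trans (leq_mul (leqnn 2) (leq_mul (leqnn C) pm2)) _.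
by rewrite [(C * _)%N]mulnCA !mulnA.
Qed.

Section moment_limit.
Context d (T : measurableType d) (R : realType) (P : probability T R).
Variables (n N : nat -> nat) (y : forall p, 'I_(N p) -> T -> R).
Variables (lam : nat -> T -> R) (C : nat).
Hypotheses (pN : forall p, (p <= N p)%N) (Nn : forall p, (N p <= 2 * n p)%N).
Hypothesis nC : \forall p \near \oo, (n p <= C * p)%N.
Hypothesis wy : forall p, wick P (@y p).
Hypothesis lam0 : forall p w, 0 <= lam p w.
Hypothesis lam_le : forall p (f : nat -> R) w,
  lam p w * (\sum_(i < p) f i ^+ 2) <=
  (n p)%:R^-1 * \sum_t (lin (@y p) (window p f t) w) ^+ 2.
Variables (kappa : R) (k1 : 1 <= kappa).

Let integral_small (e : R) : 0 < e ->
  \forall p \near \oo, (\int[P]_w (lam p w `^ kappa)%:E <= e%:E)%E.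
Proof.
move=> e0; pose K := (Num.truncn kappa).+1.
have kK : kappa <= K%:R by apply/ltW; exact: truncnS_gt.
(* the bounds for the exponents 1 and K are added; in each of them, three terms are
   at most e / 8, and t times M accounts for e / 4 in all *)
pose M k : R := 1 + 2 ^+ (2 * k) * gauss_mom R (2 * (2 * k)).
pose t := e / (8 * (1 + `|M 1%N| + `|M K|)).
have M0 : 0 < 1 + `|M 1%N| + `|M K| by rewrite !ltr_pwDl.
have t0 : 0 < t by rewrite divr_gt0// mulr_gt0.
have tM : t * M 1%N + t * M K <= e / 4.
  rewrite -mulrDr /t mulrAC ler_pdivrMr ?mulr_gt0//.
  rewrite (_ : e / 4 * _ = e * (2 * (1 + `|M 1%N| + `|M K|))); last by field.
  rewrite ler_pM2l//; have := ler_norm (M 1%N); have := ler_norm (M K).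
  have := normr_ge0 (M 1%N); have := normr_ge0 (M K); lra.
have eps0 : 0 < Num.min 1 (e * t / 16) by rewrite lt_min ltr01 divr_gt0// mulr_gt0.
have [q [q0 q1 qX /andP[qX2 qeps]]] := concentrated_weight eps0.
have {qeps} [qe1 qe2] : gaussE (q * 'X^2) <= 1 /\ gaussE (q * 'X^2) <= e * t / 16.
  by move: qeps; rewrite le_min => /andP.
set eps := gaussE (q * 'X^2) in qX2 qe1 qe2.
pose g := gaussE (q ^+ 2).
have et0 : 0 < e * t by rewrite mulr_gt0.
have nat_ge (a : R) : exists2 k, (0 < k)%N & a <= k%:R.
  by exists (Num.truncn a).+1 => //; apply/ltW; exact: truncnS_gt.
have [m m0 m64] := nat_ge (64 / (e * t)).
pose B0 := (4 * C * m)%N.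
pose G : R := (Num.max 1 `|g|) ^+ (B0 * 2).
have G1 : 1 <= Num.max 1 `|g| by rewrite le_max lexx.
have G0 : 0 <= G by rewrite exprn_ge0// (le_trans _ G1).
have [J0 J00 J016] := nat_ge (16 * G / (e * t)).
near=> p.
have pbig : (m * (2 * J0 + 1) <= p)%N by near: p; exact: nbhs_infty_ge.
have npC : (n p <= C * p)%N by near: p.
have [b [J [J0J Jb mb B0le]]] := block_count m0 J00 pbig (Nn p) npC.
have Jpos : (0 < J)%N by exact: leq_trans J0J.
have p0 : (0 < p)%N by apply: leq_trans pbig; rewrite muln_gt0 m0 addn1.
have pR : 0 < p%:R :> R by rewrite ltr0n.
have qX21 : 0 <= gaussE (q * 'X^2) <= 1 by rewrite qX2 qe1.
have bound k : (0 < k)%N -> exists F,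
    [/\ has_moments P F, forall w, lam p w ^+ k <= F w & Ex P F <= e * (3 / 8) + t * M k].
  move=> k0; have [F [hF lF EF]] := lam_power_bound p0 (pN p) (Nn p) Jpos Jb (wy p)
    q0 q1 qX qX21 (lam0 p) (@lam_le p) k0 t0.
  exists F; split => //; apply: le_trans EF _; rewrite -/(M k) lerD2r -/eps -/g.
  have t1 : 2 * eps / t <= e / 8.
    by rewrite ler_pdivrMr//; lra.
  have t2 : 2 * ((4 * b)%:R / p%:R) / t <= e / 8.
    have bp : (4 * b)%:R / p%:R <= 4 / m%:R :> R.
      rewrite ler_pdivrMr// mulrAC ler_pdivlMr ?ltr0n// -!natrM ler_nat -mulnA leq_mul2l.
      by rewrite [(b * m)%N]mulnC mb orbT.
    have m4 : 4 / m%:R <= e * t / 16.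
      rewrite ler_pdivrMr ?ltr0n//; move: m64; rewrite ler_pdivrMr//; lra.
    by rewrite ler_pdivrMr//; lra.
  have t3 : 2 * (g ^+ (N p %/ b * 2) / J%:R) / t <= e / 8.
    have gG : g ^+ (N p %/ b * 2) <= G.
      apply: le_trans (ler_norm _) _; rewrite normrX.
      apply: (@le_trans _ _ (Num.max 1 `|g| ^+ (N p %/ b * 2))).
        have gm : `|g| <= Num.max 1 `|g| by rewrite le_max lexx orbT.
        by apply: lerXn2r => //; rewrite nnegrE (le_trans ler01).
      by rewrite ler_weXn2l// leq_mul2r.
    have JR : J0%:R <= J%:R :> R by rewrite ler_nat.
    have GJ : g ^+ (N p %/ b * 2) / J%:R <= e * t / 16.
      rewrite ler_pdivrMr ?ltr0n//; apply: le_trans gG _.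
      have : G <= e * t / 16 * J0%:R by move: J016; rewrite ler_pdivrMr//; lra.
      move/le_trans; apply; rewrite ler_pM2l// divr_gt0//.
    by rewrite ler_pdivrMr//; lra.
  rewrite mulrDr mulrDl; lra.
have [F1 [hF1 lF1 EF1]] := bound 1%N isT.
have [FK [hFK lFK EFK]] := bound K isT.
apply: (@le_trans _ _ (\int[P]_w (F1 w + FK w)%:E)%E).
  apply: ge0_le_integral_nomeas => w; first by rewrite lee_fin powR_ge0.
  by rewrite lee_fin (le_trans (powR_le_expr (lam0 p w) k1 kK))// lerD.
rewrite -EFin_Ex; last exact: has_momentsD.
rewrite lee_fin ExD//; lra.
Unshelve. all: by end_near. Qed.

Lemma moment_cvg0 : (fun p => \int[P]_w (lam p w `^ kappa)%:E)%E @ \oo --> 0%E.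
Proof.
have int0 p : (0 <= \int[P]_w (lam p w `^ kappa)%:E)%E.
  by apply: integral_ge0 => w _; rewrite lee_fin powR_ge0.
have fin p (e : R) : (\int[P]_w (lam p w `^ kappa)%:E <= e%:E)%E ->
    (\int[P]_w (lam p w `^ kappa)%:E)%E \is a fin_num.
  by move=> le_e; rewrite ge0_fin_numE// (le_lt_trans le_e)// ltry.
apply/fine_cvgP; split.
  by near do apply: (fin _ 1); exact: integral_small.
apply/cvgrPdist_le => e e0; near=> p.
have le_e : (\int[P]_w (lam p w `^ kappa)%:E <= e%:E)%E.
  by near: p; exact: integral_small.
rewrite sub0r normrN ger0_norm/= ?fine_ge0//.
by rewrite -lee_fin fineK// (fin _ e).
Unshelve. all: by end_near. Qed.

End moment_limit.

Lemma wick_comp d (T : measurableType d) (R : realType) (P : probability T R)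
    (I I' : eqType) (z : I -> T -> R) (h : I' -> I) :
  injective h -> wick P z -> wick P (fun i => z (h i)).
Proof.
move=> ih [hz wz]; split=> // b l.
have E s : (fun w => \prod_(a <- s) z (h a) w) = (fun w => \prod_(a <- map h s) z a w).
  by apply/funext => w; rewrite big_map.
have -> : (fun w => z (h b) w * \prod_(a <- l) z (h a) w) =
    (fun w => z (h b) w * \prod_(a <- map h l) z a w).
  by apply/funext => w; rewrite big_map.
rewrite wz E count_map; congr (_%:R * Ex P _).
  by apply: eq_count => a /=; rewrite inj_eq.
suff -> : rem (h b) (map h l) = map h (rem b l) by [].
by elim: l => //= a l ->; rewrite inj_eq//; case: eqP.
Qed.

Lemma ratio_bounded (R : realType) (c : R) (n : nat -> nat) : 0 < c ->
  (forall p, (p <= n p)%N) ->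
  (fun p : nat => p%:R / (n p)%:R : R) @ \oo --> c ->
  exists C : nat, \forall p \near \oo, (n p <= C * p)%N.
Proof.
move=> c0 pn hc; exists (Num.truncn (2 / c)).+1; near=> p.
have p0 : (0 < p)%N by near: p; exact: nbhs_infty_gt.
have nR : 0 < (n p)%:R :> R by rewrite ltr0n (leq_trans p0).
have : c / 2 < p%:R / (n p)%:R.
  by near: p; apply: (cvgr_gt c); rewrite // ltr_pdivrMr// ltr_pMr// ltr1n.
rewrite ltr_pdivlMr// => cn; rewrite -(ler_nat R) natrM.
have C2 : 2 / c < (Num.truncn (2 / c)).+1%:R by exact: truncnS_gt.
apply: (@le_trans _ _ (2 / c * p%:R)); last by rewrite ler_wpM2r// ltW.
by rewrite mulrAC ler_pdivlMr//; lra.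
Unshelve. all: by end_near. Qed.

Theorem theorem2 (d : measure_display) (T : measurableType d) (R : realType)
    (P : probability T R) (x : int -> {RV P >-> R}) (hx : iid_std_normal x)
    (c : R) (c_gt0 : 0 < c) (c_le1 : c <= 1)
    (n : nat -> nat) (hn : forall p : nat, (p <= n p)%N)
    (hc : (fun p : nat => p%:R / (n p)%:R : R) @ \oo --> c)
    (kappa : R) (hkappa : 1 <= kappa) :
  ((fun p : nat =>
      ('E_P[(fun w : T => (min_eigenvalue
               (sample_cov (toeplitz_mx p (n p) (fun i : int => x i w)))
             `^ kappa)%R)])%E) @ \oo --> 0%E)
  /\
  ((fun p : nat =>
      ('E_P[(fun w : T => (min_eigenvalue
               (sample_cov (circulant_mx p (n p) (fun i : int => x i w)))
             `^ kappa)%R)])%E) @ \oo --> 0%E).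
Proof.
have wx := iid_wick hx.
have [C nC] := ratio_bounded c_gt0 hn hc.
rewrite unlock; split.
(* x_(1-p), ..., x_(n-1) are placed on a cycle, the negative indices last; the first n
   positions on the cycle give the columns of the Toeplitz matrix *)
- pose N p := (n p + p).-1.
  pose h p (s : 'I_(N p)) : int := if (s < n p)%N then s%:Z else s%:Z - (N p)%:Z.
  have ih p : injective (@h p).
    move=> s s' H; apply: ord_inj; move: H; rewrite /h.
    by have := ltn_ord s; have := ltn_ord s'; case: ifP; case: ifP; lia.
  apply: (@moment_cvg0 _ _ _ P n N (fun p s => x (h p s) : T -> R)
    (fun p w => min_eigenvalue (sample_cov (toeplitz_mx p (n p) (fun i : int => x i w)))) C) => //.
  + move=> p; have := hn p; rewrite /N; lia.
  + move=> p; have := hn p; rewrite /N; lia.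
  + by move=> p; exact: (wick_comp (@ih p) wx).
  + by move=> p w; exact: min_eigenvalue_ge0.
  move=> p f w; case: p => [|p].
    by rewrite big_ord0 mulr0 mulr_ge0// sumr_ge0// => t _; exact: sqr_ge0.
  apply: le_trans (min_eigenvalue_le _ (fun i => f i)) _.
  rewrite ler_wpM2l ?invr_ge0//.
  have nN : (n p.+1 <= N p.+1)%N by rewrite /N addnS leq_addr.
  have pN : (p.+1 <= N p.+1)%N by exact: leq_trans (hn _) nN.
  rewrite [leRHS](bigID (fun t : 'I_(N p.+1) => (t < n p.+1)%N)) /=.
  rewrite (big_ord_narrow nN) -[leLHS]addr0 lerD ?sumr_ge0// => [|t _]; last exact: sqr_ge0.
  apply: ler_sum => t _; rewrite (lin_window _ _ _ _ pN) le_eqVlt; apply/orP; left.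
  apply/eqP; congr (_ ^+ 2); apply: eq_bigr => i _; rewrite mxE; congr (_ * x _ w).
  rewrite /h; have [it|ti] := leqP i t.
    rewrite reflect_ord_le//=; have := ltn_ord t; case: ifP; lia.
  rewrite reflect_ord_gt//=; have := ltn_ord t; have := ltn_ord i; have := hn p.+1.
  rewrite /N; case: ifP; lia.
- have ih p : injective (fun s : 'I_(n p) => s%:Z) by move=> s s' [] /ord_inj.
  apply: (@moment_cvg0 _ _ _ P n n (fun p (s : 'I_(n p)) => x s%:Z : T -> R)
    (fun p w => min_eigenvalue (sample_cov (circulant_mx p (n p) (fun i : int => x i w)))) C) => //.
  + by move=> p; rewrite mul2n -addnn leq_addr.
  + by move=> p; exact: (wick_comp (@ih p) wx).
  + by move=> p w; exact: min_eigenvalue_ge0.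
  move=> p f w; apply: le_trans (min_eigenvalue_le _ (fun i => f i)) _.
  rewrite le_eqVlt; apply/orP; left; apply/eqP; congr (_ * _); apply: eq_bigr => t _.
  rewrite (lin_window _ _ _ _ (hn p)); congr (_ ^+ 2); apply: eq_bigr => i _.
  rewrite mxE; congr (_ * x _ w); rewrite /reflect_ord /=.
  rewrite -modz_nat -[LHS]modzDr; congr (_ %% _)%Z.
  have := ltn_ord t; have := ltn_ord i; have := hn p; lia.
Qed.
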